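(* Let $K$ be a two-bridge knot. Then $\operatorname{rad}\eta=\mathrm{Rep}'(K,\mathbb{E}_p)$.
   Context: Let $p$ be a prime, and let $\mathbb{F}_p\subset\mathbb{E}_p$ be the finite fields with $p$ and $p^2$ elements. For $x\in\mathbb{E}_p$, $\bar x$ is the conjugate of $x$ over $\mathbb{F}_p$. Fix $\theta\in\mathbb{E}_p$ with $\mathbb{E}_p=\mathbb{F}_p(\theta)$ and $\theta\bar\theta=1$; its minimal polynomial over $\mathbb{F}_p$ is $h=t^2+\kappa t+1$. Fix a non-zero $\mathfrak{i}\in\mathbb{E}_p$ with $\bar{\mathfrak{i}}=-\mathfrak{i}$. Let $\Lambda_p=\mathbb{F}_p[t,t^{-1}]$, and make $\mathbb{E}_p$ a $\Lambda_p$-module by $tx=\theta x$. Let $K$ be an oriented link in $S^3$ with diagram $D$. At each crossing $c$ let $\omega(c)$ be the overcrossing arc, $\lambda(c)$ the undercrossing arc to the left of $\omega(c)$, $\rho(c)$ the undercrossing arc to the right of $\omega(c)$, and $\mathrm{sign}(c)=\pm1$ the sign of the crossing. The Alexander module $A_p(K)$ is the $\Lambda_p$-module generated by the arcs of $D$ with one relation $\lambda(c)=t\rho(c)+(1-t)\omega(c)$ for each crossing $c$. Put $\mathrm{Rep}(K,\mathbb{E}_p)=\mathrm{Hom}_{\Lambda_p}(A_p(K),\mathbb{E}_p)$, a vector space over $\mathbb{E}_p$, and define the Hermitian form $\eta$ on it by $\eta(f,g)=\sum_c \mathrm{sign}(c)\,\mathfrak{i}\bigl(f\rho(c)\overline{g\omega(c)}-f\omega(c)\overline{g\rho(c)}\bigr)$,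 the sum being over all crossings of $D$. Its radical $\operatorname{rad}\eta$ is the set of $g$ with $\eta(f,g)=0$ for all $f\in\mathrm{Rep}(K,\mathbb{E}_p)$. Let $A'_p(K)=\{a\in A_p(K): ha=0\}$, and let $\mathrm{Rep}'(K,\mathbb{E}_p)$ be its annihilator, i.e. the set of $f\in\mathrm{Rep}(K,\mathbb{E}_p)$ vanishing on $A'_p(K)$. *)

(* Defs.v *)
From HB Require Import structures.
From Stdlib Require Import Relation_Operators.
From mathcomp Require Import all_boot all_order all_algebra all_field.
From mathcomp Require Import boolp classical_sets.
From mathcomp Require Import zify ring.

Set Implicit Arguments.
Unset Strict Implicit.
Unset Printing Implicit Defensive.

Import GRing.Theory.
Local Open Scope ring_scope.

(** * Oriented link diagrams

A diagram in general position with respect to the height function of the plane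
is cut by horizontal lines into slices, each containing one local minimum
([Cup]), one local maximum ([Cap]) or one crossing.  The slices are listed from
bottom to top; the strands met by a horizontal line are numbered from left to
right, starting at 0, and the line is described by the list of the directions of
these strands ([true] = upwards).

- [Cup i b] creates strands [i] and [i+1], strand [i] going in direction [b];
- [Cap i] joins strands [i] and [i+1];
- [Cross i s] crosses strands [i] and [i+1]; the overcrossing strand is the one
  going from bottom left to top right if [s], and the other one otherwise. *)

Inductive slice : Type :=
| Cup of nat & bool
| Cap of nat
| Cross of nat & bool.

Definition step (a : slice) (s : seq bool) : option (seq bool) :=
  match a with
  | Cup i b =>
      if (i <= size s)%N then Some (take i s ++ [:: b; ~~ b] ++ drop i s)
      else None
  | Cap i =>
      if (i.+1 < size s)%N && (nth true s i != nth true s i.+1)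
      then Some (take i s ++ drop i.+2 s) else None
  | Cross i _ =>
      if (i.+1 < size s)%N
      then Some (take i s ++ [:: nth true s i.+1; nth true s i] ++ drop i.+2 s)
      else None
  end.

Definition run (w : seq slice) : option (seq bool) :=
  foldl (fun o a => obind (step a) o) (Some [::]) w.

Record diagram := Diagram {
  slices :> seq slice;
  diagramP : run slices = Some [::] }.

Section Diagram.
Variable D : diagram.

Definition slice_at (k : nat) : slice := nth (Cap 0) D k.

(* The directions of the strands between slices k-1 and k. *)
Definition level (k : nat) : seq bool := odflt [::] (run (take k D)).

(* The point (k, j) is the point of strand j between slices k-1 and k. *)
Definition points : seq (nat * nat) :=
  [seq (k, j) | k <- iota 0 (size D).+1, j <- iota 0 (size (level k))].

Definition point : finType := seq_sub points.

(* [through a j j']: strand j below the slice a continues as strand j' above. *)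
Definition through (a : slice) (j j' : nat) : bool :=
  match a with
  | Cup i _ => j' == (if (j < i)%N then j else j.+2)
  | Cap i => ((j < i)%N && (j' == j)) || ((i.+1 < j)%N && (j == j'.+2))
  | Cross i _ => j' == (if j == i then i.+1 else if j == i.+1 then i else j)
  end.

Definition is_under (a : slice) (j : nat) : bool :=
  if a is Cross i s then j == (if s then i.+1 else i) else false.

Definition cup_ends (a : slice) (j j' : nat) : bool :=
  if a is Cup i _ then (j == i) && (j' == i.+1) else false.

Definition cap_ends (a : slice) (j j' : nat) : bool :=
  if a is Cap i then (j == i) && (j' == i.+1) else false.

Definition turn (x y : nat * nat) : bool :=
  (x.1 == y.1) &&
  (cap_ends (slice_at x.1) x.2 y.2 ||
   (0 < x.1)%N && cup_ends (slice_at x.1.-1) x.2 y.2).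

Definition pass (x y : nat * nat) : bool :=
  (y.1 == x.1.+1) && through (slice_at x.1) x.2 y.2.

Definition strand_step (x y : nat * nat) : bool := turn x y || pass x y.

Definition arc_step (x y : nat * nat) : bool :=
  turn x y || (pass x y && ~~ is_under (slice_at x.1) x.2).

Definition strand_adj : rel point :=
  [rel x y | strand_step (val x) (val y) || strand_step (val y) (val x)].

Definition arc_adj : rel point :=
  [rel x y | arc_step (val x) (val y) || arc_step (val y) (val x)].

Definition num_components : nat := n_comp strand_adj predT.

Lemma arc_connect_sym : connect_sym arc_adj.
Proof. by apply: sym_connect_sym => x y; apply: orbC. Qed.

(* An arc (a component of the diagram broken at the undercrossings) is given by
   the representative point of its class. *)
Definition arc : finType := {x : point | x \in fingraph.roots arc_adj}.

Definition arc_of (x : point) : arc :=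
  exist _ (fingraph.root arc_adj x) (roots_root arc_connect_sym x).

Definition is_cross (a : slice) : bool := if a is Cross _ _ then true else false.
Definition cross_pos (a : slice) : nat := if a is Cross i _ then i else 0.
Definition cross_over (a : slice) : bool := if a is Cross _ s then s else true.

Definition crossing : finType := {k : 'I_(size D) | is_cross (slice_at k)}.

Lemma mem_points k j :
  ((k, j) \in points) = (k <= size D)%N && (j < size (level k))%N.
Proof.
apply/allpairsPdep/andP => [[k' [j' [+ + [-> ->]]]]|[hk hj]].
  by rewrite !mem_iota !add0n !leq0n ltnS.
by exists k, j; rewrite !mem_iota !add0n !leq0n ltnS.
Qed.

Lemma run_take_Some k : exists s, run (take k D) = Some s.
Proof.
case e: (run (take k D)) => [s|]; first by exists s.
have := diagramP D; rewrite -(cat_take_drop k D) /run foldl_cat.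
by rewrite -/(run _) e; elim: (drop k D).
Qed.

Lemma level_step k : (k < size D)%N ->
  step (slice_at k) (level k) = Some (level k.+1).
Proof.
move=> hk; rewrite /level.
have [s es] := run_take_Some k; have [s' es'] := run_take_Some k.+1.
rewrite es' -es'; move: es.
rewrite (take_nth (Cap 0) hk) /run -cats1 foldl_cat /= => ->.
by [].
Qed.

Section Crossing.
Variable c : crossing.

Let a := slice_at (val c).

Lemma corner_subproof (top right : bool) :
  ((val c + top)%N, (cross_pos a + right)%N) \in points.
Proof.
rewrite mem_points; have hk := ltn_ord (val c).
rewrite (_ : (val c + top <= size D)%N); last by case: top; lia.
have := level_step hk; have := valP c; rewrite /= /a.
case: (slice_at _) => // i s _ /=; case: ifP => // hi [elevel].
case: top; rewrite ?addn0 ?addn1 /=; last by case: right; lia.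
rewrite -elevel !size_cat /= size_drop size_takel; last by lia.
by case: right; lia.
Qed.

Definition corner (top right : bool) : point := SeqSub (corner_subproof top right).

Definition direction (right : bool) : bool :=
  nth true (level (val c)) (cross_pos a + right).

Definition over_up : bool := direction (~~ cross_over a).

Definition omega : arc := arc_of (corner false (~~ cross_over a)).

(* To the left of an overcrossing strand going to the top right (resp. bottom
   left, top left, bottom right) lies the top left (resp. bottom right, bottom
   left, top right) end of the undercrossing strand. *)
Definition lambda : arc :=
  arc_of (corner (cross_over a == over_up) (~~ over_up)).

Definition rho : arc :=
  arc_of (corner (cross_over a != over_up) over_up).

(* With both strands going upwards, the crossing is positive when the strand
   going to the right is the overcrossing one; reversing one strand changes the
   sign. *)
Definition sign : int :=
  if cross_over a == (direction false == direction true) then 1 else -1.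

End Crossing.

End Diagram.

(** * Isotopy of links

Two diagrams represent isotopic links if and only if they are related by the
following moves of Freyd-Yetter and Turaev: the first five are planar isotopies,
the others are the Reidemeister moves.  Orientations are constrained only by the
requirement that both words are diagrams. *)

Definition slice_pos (a : slice) : nat :=
  match a with Cup i _ => i | Cap i => i | Cross i _ => i end.

Definition slice_in (a : slice) : nat := if a is Cup _ _ then 0 else 2.
Definition slice_out (a : slice) : nat := if a is Cap _ then 0 else 2.

Definition set_pos (i : nat) (a : slice) : slice :=
  match a with Cup _ b => Cup i b | Cap _ => Cap i | Cross _ s => Cross i s end.

Inductive local_move : seq slice -> seq slice -> Prop :=
| Exchange (a b : slice) : (slice_pos a + slice_in a <= slice_pos b)%N ->
    local_move [:: b; a]
      [:: a; set_pos (slice_pos b - slice_in a + slice_out a) b]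
| ZigzagL i b : local_move [:: Cup i b; Cap i.+1] [::]
| ZigzagR i b : local_move [:: Cup i.+1 b; Cap i] [::]
| SlideCup i b s :
    local_move [:: Cup i b; Cross i.+1 s] [:: Cup i.+1 b; Cross i (~~ s)]
| SlideCap i s :
    local_move [:: Cross i.+1 s; Cap i] [:: Cross i (~~ s); Cap i.+1]
| R1Cup i b s : local_move [:: Cup i b; Cross i s] [:: Cup i (~~ b)]
| R1Cap i s : local_move [:: Cross i s; Cap i] [:: Cap i]
| R2 i s : local_move [:: Cross i s; Cross i (~~ s)] [::]
(* The three strands must not pass cyclically over one another. *)
| R3 i s12 s13 s23 : (s12 == s13) || (s13 == s23) ->
    local_move [:: Cross i s12; Cross i.+1 s13; Cross i s23]
               [:: Cross i.+1 s23; Cross i s13; Cross i.+1 s12].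

Definition move (D D' : diagram) : Prop :=
  exists u l r v : seq slice,
    [/\ local_move l r, slices D = u ++ l ++ v & slices D' = u ++ r ++ v].

Definition isotopic : diagram -> diagram -> Prop := clos_refl_sym_trans diagram move.

Definition num_maxima (D : diagram) : nat :=
  count (fun a => if a is Cap _ then true else false) D.

Definition bridge_number (D : diagram) (b : nat) : Prop :=
  (exists2 D', isotopic D D' & num_maxima D' = b) /\
  (forall D', isotopic D D' -> (b <= num_maxima D')%N).

Definition two_bridge_knot (D : diagram) : Prop :=
  num_components D = 1 /\ bridge_number D 2.

(* Laurent polynomials form the subring F[t, 1/t] of F(t). *)

Section Laurent.
Variable F : fieldType.

Local Notation "q %:F" := (@FracField.tofrac {poly F} q).

Definition laurent_pred : {pred {fraction {poly F}}} :=
  fun x => `[< exists nq : nat * {poly F}, x * 'X%:F ^+ nq.1 = nq.2%:F >].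

Lemma laurent_subring : subring_closed laurent_pred.
Proof.
split.
- by apply/asboolP; exists (0, 1); rewrite mul1r rmorph1.
- move=> x y /asboolP[[n q] /= hx] /asboolP[[m r] /= hy]; apply/asboolP.
  exists ((n + m)%N, q * 'X ^+ m - r * 'X ^+ n) => /=.
  by rewrite rmorphB !rmorphM !rmorphXn /= -hx -hy exprD; ring.
- move=> x y /asboolP[[n q] /= hx] /asboolP[[m r] /= hy]; apply/asboolP.
  exists ((n + m)%N, q * r) => /=.
  by rewrite rmorphM /= -hx -hy exprD; ring.
Qed.

HB.instance Definition _ :=
  GRing.isSubringClosed.Build {fraction {poly F}} laurent_pred laurent_subring.

Record laurent := Laurent {
  laurent_val : {fraction {poly F}};
  laurent_valP : laurent_val \in laurent_pred }.

HB.instance Definition _ := [isSub for laurent_val].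
HB.instance Definition _ := [Choice of laurent by <:].
HB.instance Definition _ := [SubChoice_isSubComNzRing of laurent by <:].

Lemma laurent_poly_subproof (q : {poly F}) : q%:F \in laurent_pred.
Proof. by apply/asboolP; exists (0, q); rewrite mulr1. Qed.

Definition laurent_poly (q : {poly F}) : laurent :=
  Laurent (laurent_poly_subproof q).

Definition laurent_t : laurent := laurent_poly 'X.

Lemma laurentP (x : laurent) :
  exists nq : nat * {poly F}, laurent_val x * 'X%:F ^+ nq.1 == nq.2%:F.
Proof. by have /asboolP[nq e] := laurent_valP x; exists nq; apply/eqP. Qed.

Section Eval.
Variables (E : fieldExtType F) (theta : E).

Definition laurent_eval (x : laurent) : E :=
  let nq := xchoose (laurentP x) in
  (map_poly (in_alg E) nq.2).[theta] / theta ^+ nq.1.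

Hypothesis theta_neq0 : theta != 0.

Lemma laurent_evalE x n q : laurent_val x * 'X%:F ^+ n = q%:F ->
  laurent_eval x = (map_poly (in_alg E) q).[theta] / theta ^+ n.
Proof.
rewrite /laurent_eval; have := xchooseP (laurentP x).
move: (xchoose _) => -[m r] /= /eqP hr hq.
have eqr : r * 'X ^+ n = q * 'X ^+ m.
  apply/eqP; rewrite -tofrac_eq !rmorphM !rmorphXn /= -hr -hq; apply/eqP; ring.
have := congr1 (fun u => (map_poly (in_alg E) u).[theta]) eqr.
rewrite !rmorphM !rmorphXn /= map_polyX !hornerM !hornerXn => e.
by apply/eqP; rewrite eqr_div ?expf_neq0 // e.
Qed.

Lemma laurent_eval1 : laurent_eval 1 = 1.
Proof.
by rewrite (@laurent_evalE _ 0 1) ?rmorph1 ?mulr1 // hornerC divr1.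
Qed.

Lemma laurent_evalM : {morph laurent_eval : x y / x * y}.
Proof.
move=> x y; have [[n q] /= /eqP hx] := laurentP x; have [[m r] /= /eqP hy] := laurentP y.
rewrite (laurent_evalE hx) (laurent_evalE hy) (@laurent_evalE _ (n + m) (q * r)).
  by rewrite rmorphM hornerM exprD invfM; ring.
by rewrite rmorphM /= -hx -hy exprD; ring.
Qed.

Lemma laurent_evalD : {morph laurent_eval : x y / x + y}.
Proof.
move=> x y; have [[n q] /= /eqP hx] := laurentP x; have [[m r] /= /eqP hy] := laurentP y.
rewrite (laurent_evalE hx) (laurent_evalE hy).
rewrite (@laurent_evalE _ (n + m) (q * 'X ^+ m + r * 'X ^+ n)).
  rewrite rmorphD !rmorphM !rmorphXn /= map_polyX hornerD !hornerM !hornerXn exprD.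
  by field; rewrite !expf_neq0.
by rewrite rmorphD !rmorphM !rmorphXn /= -hx -hy exprD; ring.
Qed.

End Eval.
End Laurent.

(* E as a module over F[t, 1/t] on which t acts as multiplication by theta *)

Section ThetaModule.
Variables (F : fieldType) (E : fieldExtType F) (theta : E).

Definition theta_module of theta != 0 : Type := E.

Variable theta_neq0 : theta != 0.

Local Notation M := (theta_module theta_neq0).

HB.instance Definition _ := GRing.Zmodule.copy M E.

Definition theta_scale (x : laurent F) (v : M) : M := laurent_eval theta x * (v : E).

Lemma theta_scaleA x y v :
  theta_scale x (theta_scale y v) = theta_scale (x * y) v.
Proof. by rewrite /theta_scale laurent_evalM // mulrA. Qed.

Lemma theta_scale1 : left_id 1 theta_scale.
Proof. by move=> v; rewrite /theta_scale laurent_eval1 // mul1r. Qed.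

Lemma theta_scaleDr : right_distributive theta_scale +%R.
Proof. by move=> x u v; apply: mulrDr. Qed.

Lemma theta_scaleDl v : {morph theta_scale^~ v : x y / x + y}.
Proof. by move=> x y; rewrite /theta_scale laurent_evalD // mulrDl. Qed.

HB.instance Definition _ :=
  GRing.Zmodule_isLmodule.Build (laurent F) M
    theta_scaleA theta_scale1 theta_scaleDr theta_scaleDl.

Lemma theta_scale_t (v : M) : laurent_t F *: v = theta * (v : E) :> E.
Proof.
rewrite /GRing.scale /= /theta_scale (@laurent_evalE _ _ _ theta_neq0 _ 0 'X).
  by rewrite map_polyX hornerX divr1.
by rewrite mulr1.
Qed.

End ThetaModule.

(* The module with generators [G] and relations [r c = 0], for [c : C] *)

Section Presentation.
Variables (R : comNzRingType) (G C : finType) (r : C -> {ffun G -> R^o}).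

Definition relation_span : {pred {ffun G -> R^o}} :=
  fun v => `[< exists x : C -> R, v = \sum_c x c *: r c >].

Lemma relation_spanZ x v : v \in relation_span -> x *: v \in relation_span.
Proof.
move=> /asboolP[y ->]; apply/asboolP; exists (fun c => x * y c).
by rewrite scaler_sumr; apply: eq_bigr => c _; rewrite scalerA.
Qed.

Lemma relation_span_zmod : zmod_closed relation_span.
Proof.
split=> [|u v /asboolP[x ->] /asboolP[y ->]]; apply/asboolP.
  by exists (fun=> 0); rewrite big1 // => c _; rewrite scale0r.
exists (fun c => x c - y c); rewrite -sumrB.
by apply: eq_bigr => c _; rewrite scalerBl.
Qed.

HB.instance Definition _ :=
  GRing.isZmodClosed.Build {ffun G -> R^o} relation_span relation_span_zmod.

Definition presented : Type := Quotient.quot relation_span.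

HB.instance Definition _ := GRing.Zmodule.on presented.

Definition presented_proj (v : {ffun G -> R^o}) : presented :=
  (\pi_(Quotient.quot relation_span) v)%qT.

Definition presented_gen (g : G) : presented :=
  presented_proj [ffun g' => (g' == g)%:R].

Definition presented_scale (x : R) (q : presented) : presented :=
  presented_proj (x *: repr (q : Quotient.quot relation_span)).

Lemma presented_scaleE x v :
  presented_scale x (presented_proj v) = presented_proj (x *: v).
Proof.
apply/eqP; rewrite /presented_scale -Quotient.idealrBE -scalerBr.
by apply: relation_spanZ; rewrite Quotient.idealrBE reprK.
Qed.

Lemma presented_projD : {morph presented_proj : u v / u + v}.
Proof. by move=> u v; rewrite /presented_proj !piE. Qed.

Lemma presentedW (P : presented -> Prop) :
  (forall v, P (presented_proj v)) -> forall q, P q.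
Proof. by move=> hP; apply: quotW. Qed.

Lemma presented_scaleA x y q :
  presented_scale x (presented_scale y q) = presented_scale (x * y) q.
Proof. by elim/presentedW: q => v; rewrite !presented_scaleE scalerA. Qed.

Lemma presented_scale1 : left_id 1 presented_scale.
Proof. by elim/presentedW => v; rewrite presented_scaleE scale1r. Qed.

Lemma presented_scaleDr : right_distributive presented_scale +%R.
Proof.
move=> x; elim/presentedW => u; elim/presentedW => v.
by rewrite -presented_projD !presented_scaleE -presented_projD scalerDr.
Qed.

Lemma presented_scaleDl q : {morph presented_scale^~ q : x y / x + y}.
Proof.
move=> x y; elim/presentedW: q => v.
by rewrite !presented_scaleE -presented_projD scalerDl.
Qed.

HB.instance Definition _ :=
  GRing.Zmodule_isLmodule.Build R presented presented_scaleA presented_scale1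
    presented_scaleDr presented_scaleDl.

End Presentation.

Section Alexander.
Variable D : diagram.

Section Module.
Variable F : fieldType.
Local Notation t := (laurent_t F).

Definition alexander_relation (c : crossing D) : {ffun arc D -> (laurent F)^o} :=
  let e (a : arc D) : {ffun arc D -> (laurent F)^o} := [ffun b => (b == a)%:R] in
  e (lambda c) - (t *: e (rho c) + (1 - t) *: e (omega c)).

Definition alexander : lmodType (laurent F) := presented alexander_relation.

Definition alexander_gen (a : arc D) : alexander :=
  presented_gen alexander_relation a.

End Module.

Variables (p : nat) (E : fieldExtType 'F_p).

(* The Frobenius map is the nontrivial automorphism over F_p of a quadratic
   extension E of F_p. *)
Definition conj (x : E) : E := x ^+ p.

Lemma norm1_neq0 (theta : E) : theta * conj theta = 1 -> theta != 0.
Proof. by apply: contra_eq_neq => ->; rewrite mul0r eq_sym oner_neq0. Qed.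

Variables (theta : E) (theta_neq0 : theta != 0).

Definition Rep : Type :=
  {linear alexander 'F_p -> theta_module theta_neq0}.

Definition color (f : Rep) (a : arc D) : E := f (alexander_gen 'F_p a).

Definition eta (i : E) (f g : Rep) : E :=
  \sum_(c : crossing D) (sign c)%:~R * i *
    (color f (rho c) * conj (color g (omega c)) -
     color f (omega c) * conj (color g (rho c))).

Local Open Scope classical_set_scope.

Definition rad_eta (i : E) : set Rep := [set g | forall f, eta i f g = 0].

Definition alexander_torsion (h : {poly 'F_p}) : set (alexander 'F_p) :=
  [set a | laurent_poly h *: a = 0].

Definition Rep' (h : {poly 'F_p}) : set Rep :=
  [set f | forall a, alexander_torsion h a -> f a = 0].

End Alexander.

Arguments rad_eta D {p E theta} theta_neq0 i.
Arguments Rep' D {p E theta} theta_neq0 h.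
Arguments eta {D p E theta theta_neq0} i f g.

(* Main.v *)
Require Import Defs.
From HB Require Import structures.
From mathcomp Require Import all_boot all_order all_algebra all_field.
From mathcomp Require Import boolp classical_sets.
From mathcomp Require Import zify ring.
Import Defs.

(** A representation f is a coloring of the arcs by E satisfying the Alexander
relations at theta.  If h a is a combination of relations with coefficients Y_c,
then y = Y(theta) is a linear dependency (syzygy) of the relations at theta, and
differentiating at theta gives h'(theta) f(a) = - sum_c y_c (f rho(c) - f omega(c)),
where h'(theta) <> 0; every syzygy y arises in this way.  Hence f lies in Rep' if
and only if it pairs to zero with all syzygies.

On the other hand, f lies in the radical if and only if
sum_c sign(c) (f rho(c) g omega(c) - f omega(c) g rho(c)) = 0 for all colorings g
at theta^-1 (the conjugates of the colorings at theta).  Such a g extends to a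
coloring of the regions of the plane, and its jumps across the undercrossing
strands form a syzygy y.  With these y and g, the sum equals
- theta sum_c y_c (f rho(c) - f omega(c)): the difference telescopes when the
diagram is swept by a horizontal line.  Every syzygy comes from some g, found by
sweeping the diagram from top to bottom. *)

Set Implicit Arguments.
Unset Strict Implicit.
Unset Printing Implicit Defensive.

Import GRing.Theory.
Local Open Scope ring_scope.

(** * Rows of labelled strands across one slice *)

Section Strands.
Variable T : Type.

Definition strands (d : seq bool) (x : nat -> T) : seq (bool * T) :=
  [seq (nth true d j, x j) | j <- iota 0 (size d)].

Lemma strands_cat d1 d2 x :
  strands (d1 ++ d2) x = strands d1 x ++ strands d2 (fun j => x (size d1 + j)%N).
Proof.
rewrite /strands size_cat iotaD map_cat add0n; congr (_ ++ _).
  by apply/eq_in_map => j; rewrite mem_iota nth_cat => /andP[_ ->].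
rewrite -{1}[size d1]addn0 iotaDl -map_comp; apply: eq_map => j /=.
by rewrite nth_cat ltnNge leq_addr addKn.
Qed.

Lemma eq_strands d x x' : (forall j, (j < size d)%N -> x j = x' j) ->
  strands d x = strands d x'.
Proof. by move=> e; apply/eq_in_map => j; rewrite mem_iota => /andP[_ /e ->]. Qed.

(** Labels are functions on all of [nat], so the condition also binds indices beyond the last
    strand. *)
Definition passes (a : slice) (x x' : nat -> T) : Prop :=
  forall j j', through a j j' -> ~~ is_under a j -> x j = x' j'.

(** Both rows are cut at common parts [l1] and [l2], which confines the comparison of sums over the
    rows to the strands that the slice touches. *)
Lemma strands_cup d1 d2 b x x' : passes (Cup (size d1) b) x x' ->
  exists l1 l2,
    [/\ strands (d1 ++ d2) x = l1 ++ l2,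
        strands (d1 ++ [:: b; ~~ b] ++ d2) x' =
          l1 ++ [:: (b, x' (size d1)); (~~ b, x' (size d1).+1)] ++ l2
      & l1 = strands d1 x'].
Proof.
move=> h; exists (strands d1 x'), (strands d2 (fun j => x (size d1 + j)%N)).
split=> //; rewrite !strands_cat; congr (_ ++ _).
- by apply: eq_strands => j hj; apply: h; rewrite /= ?hj.
- rewrite /strands /= addn0 addn1; do 2!congr (_ :: _).
  apply/eq_map => j; congr (_, _); rewrite (h _ (size d1 + j).+2) ?addnS //=.
  by rewrite ltnNge leq_addr.
Qed.

Lemma strands_cap d1 d2 b b' x x' : passes (Cap (size d1)) x x' ->
  exists l1 l2,
    [/\ strands (d1 ++ d2) x' = l1 ++ l2,
        strands (d1 ++ [:: b; b'] ++ d2) x =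
          l1 ++ [:: (b, x (size d1)); (b', x (size d1).+1)] ++ l2
      & l1 = strands d1 x].
Proof.
move=> h; exists (strands d1 x), (strands d2 (fun j => x' (size d1 + j)%N)).
split=> //; rewrite !strands_cat; congr (_ ++ _).
- by apply: eq_strands => j hj; apply/esym/h; rewrite //= hj eqxx.
- rewrite /strands /= addn0 addn1; do 2!congr (_ :: _).
  apply/eq_map => j; congr (_, _); rewrite (h _ (size d1 + j)%N) //= !addnS.  
  by rewrite eqxx andbT !ltnS leq_addr orbT.
Qed.

Lemma strands_cross d1 d2 b1 b2 s x x' : passes (Cross (size d1) s) x x' ->
  exists l1 l2,
    [/\ strands (d1 ++ [:: b1; b2] ++ d2) x =
          l1 ++ [:: (b1, x (size d1)); (b2, x (size d1).+1)] ++ l2,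
        strands (d1 ++ [:: b2; b1] ++ d2) x' =
          l1 ++ [:: (b2, x' (size d1)); (b1, x' (size d1).+1)] ++ l2
      & l1 = strands d1 x].
Proof.
move=> h; exists (strands d1 x), (strands d2 (fun j => x' (size d1 + j).+2)).
split=> //; rewrite !strands_cat; congr (_ ++ _).
- rewrite /strands /= addn0 addn1; do 2!congr (_ :: _).
  apply/eq_map => j; congr (_, _); rewrite (h _ (size d1 + j).+2) //= ?addnS //.
    by apply/eqP; do 2?[case: eqP => ?]; lia.
  by case: (s); lia.
- apply: eq_strands => j hj; apply/esym/h => /=.
    by apply/eqP; do 2?[case: eqP => ?]; lia.
  by case: (s); lia.
- rewrite /strands /= addn0 addn1; do 2!congr (_ :: _).
  by apply/eq_map => j; rewrite !addnS.
Qed.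

End Strands.

Lemma passes_pair (T U : Type) a (x x' : nat -> T) (y y' : nat -> U) :
  passes a x x' -> passes a y y' ->
  passes a (fun j => (x j, y j)) (fun j => (x' j, y' j)).
Proof. by move=> hx hy j j' h1 h2; congr (_, _); [apply: hx|apply: hy]. Qed.

(** A form of [step] already split at the slice, so that case analysis yields the concatenations at
    which a row is cut. *)
Variant step_spec : slice -> seq bool -> seq bool -> Prop :=
| StepCup d1 d2 b :
    step_spec (Cup (size d1) b) (d1 ++ d2) (d1 ++ [:: b; ~~ b] ++ d2)
| StepCap d1 d2 b :
    step_spec (Cap (size d1)) (d1 ++ [:: b; ~~ b] ++ d2) (d1 ++ d2)
| StepCross d1 d2 b1 b2 s :
    step_spec (Cross (size d1) s) (d1 ++ [:: b1; b2] ++ d2)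
      (d1 ++ [:: b2; b1] ++ d2).

Lemma stepP a d d' : step a d = Some d' -> step_spec a d d'.
Proof.
case: a => [i b|i|i s] /=.
- case: ifP => // hi [<-].
  have := StepCup (take i d) (drop i d) b.
  by rewrite cat_take_drop size_takel.
- case: ifP => // /andP[hi hb] [<-].
  have := StepCap (take i d) (drop i.+2 d) (nth true d i).
  rewrite size_takel; last lia.
  have -> : ~~ nth true d i = nth true d i.+1 by move: hb; do 2!case: (nth true d _).
  by rewrite /= -!drop_nth ?cat_take_drop //; lia.
- case: ifP => // hi [<-].
  have := StepCross (take i d) (drop i.+2 d) (nth true d i) (nth true d i.+1) s.
  rewrite size_takel; last lia.
  by rewrite {2}/cat -!drop_nth ?cat_take_drop //; lia.
Qed.

(** * Region colors and the sums followed during the sweep *)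

Section Shadow.
Variables (K : fieldType) (theta : K).

(** Region colors change from left to right as undercrossing colors do in a coloring at [theta^-1]:
    [rho = theta * lambda + (1 - theta) * omega]; a downward strand inverts the rule. *)
Definition turning (b : bool) : K := if b then theta else theta^-1.

(* A strand is labelled by a pair (color, weight). *)
Implicit Type l : seq (bool * (K * K)).

(* The color of the region to the right of the strands, [s] being the color of
   the region to their left. *)
Fixpoint shadow (s : K) l : K :=
  if l is (b, (g, _)) :: l' then
    shadow (turning b * s + (1 - turning b) * g) l' else s.

(** The weights are paired with the jumps of the shadow. This linear functional of the weights will
    represent the weighted sums of relations below a level. *)
Fixpoint charge (s : K) l : K :=
  if l is (b, (g, x)) :: l' then
    let s' := turning b * s + (1 - turning b) * g in
    x * (s' - s) + charge s' l'
  else 0.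

(* The index of the regions, which drops by one across an upward strand. *)
Fixpoint rotation (n : K) l : K :=
  if l is (b, _) :: l' then rotation (if b then n - 1 else n + 1) l' else n.

(* The change of the potential at a crossing is the contribution of that crossing
   to [linking f g + theta * syzygy_pairing y f], see [row_potential_cross]. *)
Fixpoint potential (s n : K) l : K :=
  if l is (b, (g, f)) :: l' then
    let s' := turning b * s + (1 - turning b) * g in
    (if b then n else n + 1) * f * (s' - s) -
      (-1) ^+ (~~ b) * (1 - theta)^-1 * f * g +
      potential s' (if b then n - 1 else n + 1) l'
  else 0.

Lemma charge_cat s l1 l2 :
  charge s (l1 ++ l2) = charge s l1 + charge (shadow s l1) l2.
Proof. by elim: l1 s => [|[b [g x]] l1 IH] s /=; rewrite ?add0r // IH addrA. Qed.

Lemma potential_cat s n l1 l2 : potential s n (l1 ++ l2) =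
  potential s n l1 + potential (shadow s l1) (rotation n l1) l2.
Proof.
by elim: l1 s n => [|[b [g x]] l1 IH] s n /=; rewrite ?add0r // IH addrA.
Qed.

Lemma shadow_weight d (g x y : nat -> K) s :
  shadow s (strands d (fun j => (g j, x j))) =
  shadow s (strands d (fun j => (g j, y j))).
Proof. by rewrite /strands; elim: (iota _ _) s => //= j r IH s. Qed.

End Shadow.

(** * The ends of a crossing in terms of row labels *)

Section CrossingEnds.
Variables (a : slice) (d : seq bool).

(** This and the following definitions mirror [over_up], [sign], [omega], [lambda] and [rho] for a
    slice with given directions and labels, outside any diagram. *)
Definition row_up : bool := nth true d (cross_pos a + ~~ cross_over a).

Definition row_sign : int :=
  if cross_over a == (nth true d (cross_pos a + false) ==
                      nth true d (cross_pos a + true)) then 1 else -1.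

Variable T : Type.
Implicit Type x : nat -> T.

Definition row_end x x' (top right : bool) : T :=
  (if top then x' else x) (cross_pos a + right)%N.

Definition row_omega x : T := x (cross_pos a + ~~ cross_over a)%N.
Definition row_lambda x x' : T :=
  row_end x x' (cross_over a == row_up) (~~ row_up).
Definition row_rho x x' : T := row_end x x' (cross_over a != row_up) row_up.

End CrossingEnds.

Lemma nth_mid0 d1 d2 (b1 b2 : bool) :
  nth true (d1 ++ [:: b1; b2] ++ d2) (size d1) = b1.
Proof. by rewrite nth_cat ltnn subnn. Qed.

Lemma nth_mid1 d1 d2 (b1 b2 : bool) :
  nth true (d1 ++ [:: b1; b2] ++ d2) (size d1).+1 = b2.
Proof. by rewrite nth_cat ltnNge leqnSn subSnn. Qed.

Lemma over_passes i s (T : Type) (x x' : nat -> T) :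
  passes (Cross i s) x x' -> if s then x i = x' i.+1 else x i.+1 = x' i.
Proof.
case: s => h; apply: h => /=; rewrite ?eqxx //; try lia.
by apply/eqP; case: eqP; lia.
Qed.

(** * Change of charge and potential at a crossing *)

Section LocalDuality.
Variables (K : fieldType) (theta : K).
Hypotheses (theta_neq0 : theta != 0) (theta_neq1 : theta != 1).

Local Notation turning := (turning theta).

Definition row_relation (a : slice) (d : seq bool) (tau : K) (x x' : nat -> K) : K :=
  row_lambda a d x x' - (tau * row_rho a d x x' + (1 - tau) * row_omega a x).

(** The unbounded region on the left gets color 0; the weight 0 is a mere placeholder. *)
Definition row_shadow (d : seq bool) (g : nat -> K) : K :=
  shadow theta 0 (strands d (fun j => (g j, 0))).

Definition row_charge d (g x : nat -> K) : K :=
  charge theta 0 (strands d (fun j => (g j, x j))).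

Definition row_potential d (g f : nat -> K) : K :=
  potential theta 0 0 (strands d (fun j => (g j, f j))).

(* The jump of the shadow across the undercrossing strand at the end [lambda]. *)
Definition row_dual (a : slice) (d : seq bool) (g g' : nat -> K) : K :=
  let i := cross_pos a in
  let b1 := nth true d i in
  let b2 := nth true d i.+1 in
  let s0 := row_shadow (take i d) g in
  if cross_over a then
    if b1 then (1 - turning b2) * (g' i - s0)
    else - (1 - turning b2) * (g i.+1 - (turning b1 * s0 + (1 - turning b1) * g i))
  else
    if b2 then - (1 - turning b1) * (g i - s0)
    else (1 - turning b1) * (g' i.+1 - (turning b2 * s0 + (1 - turning b2) * g' i)).

Lemma row_dual_cross d1 d2 b1 b2 s g g' :
  row_dual (Cross (size d1) s) (d1 ++ [:: b1; b2] ++ d2) g g' =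
  let i := size d1 in
  let s0 := row_shadow d1 g in
  if s then
    if b1 then (1 - turning b2) * (g' i - s0)
    else - (1 - turning b2) * (g i.+1 - (turning b1 * s0 + (1 - turning b1) * g i))
  else
    if b2 then - (1 - turning b1) * (g i - s0)
    else (1 - turning b1) * (g' i.+1 - (turning b2 * s0 + (1 - turning b2) * g' i)).
Proof.
by rewrite /row_dual /= take_size_cat // !nth_cat ltnn subnn ltnNge leqnSn subSnn.
Qed.

Lemma shadow_pair d (g x : nat -> K) :
  shadow theta 0 (strands d (fun j => (g j, x j))) = row_shadow d g.
Proof. exact: shadow_weight. Qed.

(** The relation for [g] gives the region to the right of the crossing the same color below and
    above it, so all other strands cancel. The rest is an identity in each of the eight cases of
    crossing and directions. *)
Lemma row_charge_cross a d d' g g' x x' : is_cross a -> step_spec a d d' ->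
    passes a g g' -> passes a x x' ->
    row_relation a d theta^-1 g g' = 0 ->
  row_charge d' g' x' - row_charge d g x =
    row_dual a d g g' * row_relation a d theta x x'.
Proof.
move=> + h; case: h => // d1 d2 b1 b2 s _ hg hx.
have := over_passes hx; have := over_passes hg.
have [l1 [l2 [e1 e2 e3]]] := strands_cross d2 b1 b2 (passes_pair hg hx).
rewrite row_dual_cross /row_charge e1 e2 !charge_cat e3 !shadow_pair /=.
rewrite /row_relation /row_lambda /row_rho /row_omega /row_end /row_up /=.
move: (row_shadow d1 g) (charge _ 0 _) => s0 c0.
case: s {hg hx}; case: b1 {e1 e2} => /=; case: b2 => /=;
  rewrite ?addn0 ?addn1 ?nth_mid0 ?nth_mid1 => -> -> /=; rewrite ?addn0 ?addn1 => /subr0_eq ->;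
  (match goal with |- _ + (_ + charge _ ?u l2) - (_ + (_ + charge _ ?v l2)) = _ =>
     have -> : u = v by field end);
  by field.
Qed.

Lemma row_potential_cross a d d' g g' f f' : is_cross a -> step_spec a d d' ->
    passes a g g' -> passes a f f' ->
    row_relation a d theta^-1 g g' = 0 -> row_relation a d theta f f' = 0 ->
  row_potential d' g' f' - row_potential d g f =
    (row_sign a d)%:~R * (row_rho a d f f' * row_omega a g -
                          row_omega a f * row_rho a d g g') +
    theta * (row_dual a d g g' * (row_rho a d f f' - row_omega a f)).
Proof.
move=> + h; case: h => // d1 d2 b1 b2 s _ hg hf.
have := over_passes hf; have := over_passes hg.
have [l1 [l2 [e1 e2 e3]]] := strands_cross d2 b1 b2 (passes_pair hg hf).
have theta_neq1' : 1 - theta != 0 by rewrite subr_eq0 eq_sym.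
rewrite row_dual_cross /row_potential e1 e2 !potential_cat e3 !shadow_pair /=.
rewrite /row_relation /row_lambda /row_rho /row_omega /row_end /row_up /row_sign /=.
move: (row_shadow d1 g) (potential _ 0 0 _) (rotation (0 : K) _) => s0 c0 n0.
case: s {hg hf}; case: b1 {e1 e2} => /=; case: b2 => /=;
  rewrite ?addn0 ?addn1 ?nth_mid0 ?nth_mid1 => -> -> /=; rewrite ?addn0 ?addn1 => /subr0_eq -> /subr0_eq ->;
  (match goal with |- _ + (_ + potential _ ?u ?n l2) - (_ + (_ + potential _ ?v ?m l2)) = _ =>
     have -> : u = v by field end);
  (* The index of the region on the right agrees too, as the same two directions are met in either
     order. *)
  (match goal with |- _ + (_ + potential _ ?u ?n l2) - (_ + (_ + potential _ ?v ?m l2)) = _ =>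
     try have -> : n = m by ring end);
  rewrite ?rmorphN1 ?rmorph1; by field; rewrite ?theta_neq0 ?theta_neq1'.
Qed.

End LocalDuality.

(** * Continuing labels upwards and downwards across a slice *)

Section Joins.
Variable T : Type.
Implicit Type x : nat -> T.

Definition joins (a : slice) x x' : Prop :=
  [/\ passes a x x',
      forall j j', cup_ends a j j' -> x' j = x' j'
    & forall j j', cap_ends a j j' -> x j = x j'].

Lemma cup_extend i b x (t : T) : exists x',
  [/\ passes (Cup i b) x x', x' i = t & x' i.+1 = t].
Proof.
exists (fun j => if (j < i)%N then x j else if (j < i.+2)%N then t else x j.-2).
split=> [j j' /= /eqP -> _||]; last 2 first.
- by rewrite ltnn leqW.
- by rewrite ltnNge leqnSn /= ltnSn.
by case: (ltnP j i) => [->|h] //; rewrite !ifN //; lia.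
Qed.

Lemma cup_restrict i b x' : exists x, passes (Cup i b) x x'.
Proof. by exists (fun j => x' (if (j < i)%N then j else j.+2)) => j j' /eqP ->. Qed.

Lemma cap_extend i x : exists x', passes (Cap i) x x'.
Proof.
exists (fun j => x (if (j < i)%N then j else j.+2)) => j j' /=.
case/orP=> /andP[hj /eqP e] _; first by rewrite e hj.
by rewrite ifF -?e //; lia.
Qed.

Lemma cap_restrict i x' (t : T) : exists x,
  [/\ passes (Cap i) x x', x i = t & x i.+1 = t].
Proof.
exists (fun j => if (j < i)%N then x' j else if (j < i.+2)%N then t else x' j.-2).
split=> [j j' /= /orP[] /andP[hj /eqP e] _||].
- by rewrite hj e.
- by rewrite !ifN ?e //; lia.
- by rewrite ltnn leqW.
- by rewrite ltnNge leqnSn /= ltnSn.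
Qed.

(** Position [i + ~~ s] is the upper end of the undercrossing strand, the only label above that
    [passes] leaves free; [i + s] is its lower end. *)
Lemma cross_extend i s x (t : T) : exists x',
  passes (Cross i s) x x' /\ x' (i + ~~ s)%N = t.
Proof.
exists (fun j => if j == (i + ~~ s)%N then t else
                 if j == (i + s)%N then x (i + ~~ s)%N else x j).
split=> [j j' /= /eqP -> hj|]; last by rewrite eqxx.
by case: s hj => /= hj; do !case: eqP => //; rewrite ?addn0 ?addn1;
  move=> *; try (exfalso; lia); congr x; lia.
Qed.

Lemma cross_restrict i s x' (t : T) : exists x,
  passes (Cross i s) x x' /\ x (i + s)%N = t.
Proof.
exists (fun j => if j == (i + s)%N then t else
                 if j == (i + ~~ s)%N then x' (i + s)%N else x' j).
split=> [j j' /= /eqP -> hj|]; last by rewrite eqxx.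
by case: s hj => /= hj; do !case: eqP => //; rewrite ?addn0 ?addn1;
  move=> *; try (exfalso; lia); congr x'; lia.
Qed.

End Joins.

(** * Solving crossing relations; charge and potential at extrema *)

Section DualStep.
Variables (K : fieldType) (theta : K).
Hypotheses (theta_neq0 : theta != 0) (theta_neq1 : theta != 1).

(** The condition says that the end to the left of the overcrossing strand, [lambda], is the upper
    one. *)
Lemma row_relation_split a d tau (x x' : nat -> K) : is_cross a ->
  row_relation a d tau x x' =
  if cross_over a == row_up a d then
    x' (cross_pos a + ~~ cross_over a)%N -
      (tau * x (cross_pos a + cross_over a)%N +
       (1 - tau) * x (cross_pos a + ~~ cross_over a)%N)
  else
    x (cross_pos a + cross_over a)%N -
      (tau * x' (cross_pos a + ~~ cross_over a)%N +
       (1 - tau) * x (cross_pos a + ~~ cross_over a)%N).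
Proof.
rewrite /row_relation /row_lambda /row_rho /row_omega /row_end.
by case: a => // i s _; case: eqP => /= [<-|] //; case: s (row_up _ _) => [] [].
Qed.

(** The relation is solved for the upper end of the undercrossing strand, whose coefficient is 1 or
    [- tau]. *)
Lemma relation_extend a d tau (x : nat -> K) r : tau != 0 -> is_cross a ->
  exists x', passes a x x' /\ row_relation a d tau x x' = r.
Proof.
move=> tau_neq0 ha.
case: (boolP (cross_over a == row_up a d)) => hs.
  set u := tau * x (cross_pos a + cross_over a)%N +
    (1 - tau) * x (cross_pos a + ~~ cross_over a)%N.
  case: a ha hs @u => // i s _ hs u.
  have [x' [h1 h2]] := cross_extend i s x (r + u).
  by exists x'; split=> //; rewrite row_relation_split //= hs h2 addrK.
case: a ha hs => // i s _ hs.
have [x' [h1 h2]] := cross_extend i s x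
  ((x (i + s)%N - r - (1 - tau) * x (i + ~~ s)%N) / tau).
exists x'; split=> //; rewrite row_relation_split //= (negPf hs) h2.
by field.
Qed.

Lemma relation_restrict a d tau (x' : nat -> K) : tau != 0 -> is_cross a ->
  exists x, passes a x x' /\ row_relation a d tau x x' = 0.
Proof.
case: a => // i s tau_neq0 _.
have over (x : nat -> K) : passes (Cross i s) x x' -> x (i + ~~ s)%N = x' (i + s)%N.
  by move/over_passes; case: (s); rewrite /= ?addn0 ?addn1.
case: (boolP (s == row_up (Cross i s) d)) => hs.
  have [x [h1 h2]] := cross_restrict i s x'
    ((x' (i + ~~ s)%N - (1 - tau) * x' (i + s)%N) / tau).
  exists x; split=> //; rewrite row_relation_split //= hs h2 (over x) //.
  by field.
have [x [h1 h2]] := cross_restrict i s x'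
  (tau * x' (i + ~~ s)%N + (1 - tau) * x' (i + s)%N).
by exists x; split=> //; rewrite row_relation_split //= (negPf hs) h2 (over x) // subrr.
Qed.

Lemma charge_weight0 s (l : seq (bool * (K * K))) :
  all (fun u => u.2.2 == 0) l -> charge theta s l = 0.
Proof.
elim: l s => //= -[b [g x]] l IH s /= /andP[/eqP -> /IH ->].
by rewrite mul0r addr0.
Qed.

Lemma row_chargeB d (g x x0 : nat -> K) a :
  row_charge theta d g (fun j => x j - a * x0 j) =
  row_charge theta d g x - a * row_charge theta d g x0.
Proof.
rewrite /row_charge /strands; move: (0 : K); elim: (iota _ _) => [|j r IH] s /=; first by ring.
by rewrite IH; ring.
Qed.

Lemma row_charge0 d g : row_charge theta d g (fun=> 0) = 0.
Proof. by apply: charge_weight0; rewrite all_map; apply/allP => j _ /=. Qed.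

(** The two new strands have opposite directions and equal labels, so the second undoes the jump of
    the shadow across the first. *)
Lemma row_charge_cup d1 d2 b (g g' x x' : nat -> K) :
    let i := size d1 in
    passes (Cup i b) g g' -> passes (Cup i b) x x' ->
    g' i = g' i.+1 -> x' i = x' i.+1 ->
  row_charge theta (d1 ++ [:: b; ~~ b] ++ d2) g' x' =
  row_charge theta (d1 ++ d2) g x.
Proof.
move=> i hg hx eg ex; rewrite /row_charge.
have [l1 [l2 [-> -> _]]] := strands_cup d2 (passes_pair hg hx).
rewrite /= !charge_cat /= -eg -ex; move: (shadow _ 0 l1) => s.
have -> : turning theta (~~ b) * (turning theta b * s + (1 - turning theta b) * g' i) +
  (1 - turning theta (~~ b)) * g' i = s by case: b {hg hx}; rewrite /=; field.
ring.
Qed.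

(** Here [x] may differ at the two ends, whose opposite jumps then leave the last term. That term
    later determines the color of the cap. *)
Lemma row_charge_cap d1 d2 b (g g' x x' : nat -> K) :
    let i := size d1 in
    passes (Cap i) g g' -> passes (Cap i) x x' -> g i = g i.+1 ->
  row_charge theta (d1 ++ [:: b; ~~ b] ++ d2) g x =
  row_charge theta (d1 ++ d2) g' x' +
    (1 - turning theta b) * (g i - row_shadow theta d1 g) * (x i - x i.+1).
Proof.
move=> i hg hx eg; rewrite /row_charge.
have [l1 [l2 [-> -> e]]] := strands_cap d2 b (~~ b) (passes_pair hg hx).
rewrite !charge_cat {5}e shadow_pair /= e shadow_pair -eg -/i.
move: (row_shadow _ d1 g) => s.
have -> : turning theta (~~ b) * (turning theta b * s + (1 - turning theta b) * g i) +
  (1 - turning theta (~~ b)) * g i = s by case: (b); rewrite /=; field.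
ring.
Qed.

Lemma row_potential_cup d1 d2 b (g g' x x' : nat -> K) :
    let i := size d1 in
    passes (Cup i b) g g' -> passes (Cup i b) x x' ->
    g' i = g' i.+1 -> x' i = x' i.+1 ->
  row_potential theta (d1 ++ [:: b; ~~ b] ++ d2) g' x' =
  row_potential theta (d1 ++ d2) g x.
Proof.
move=> i hg hx eg ex; rewrite /row_potential.
have [l1 [l2 [-> -> _]]] := strands_cup d2 (passes_pair hg hx).
rewrite /= !potential_cat /= -eg -ex; move: (shadow _ 0 l1) (rotation _ l1) => s n.
have -> : turning theta (~~ b) * (turning theta b * s + (1 - turning theta b) * g' i) +
  (1 - turning theta (~~ b)) * g' i = s by case: b {hg hx}; rewrite /=; field.
by case: b {hg hx} => /=; rewrite ?subrK ?addrK; ring.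
Qed.

Lemma row_potential_cap d1 d2 b (g g' x x' : nat -> K) :
    let i := size d1 in
    passes (Cap i) g g' -> passes (Cap i) x x' ->
    g i = g i.+1 -> x i = x i.+1 ->
  row_potential theta (d1 ++ d2) g' x' =
  row_potential theta (d1 ++ [:: b; ~~ b] ++ d2) g x.
Proof.
move=> i hg hx eg ex; rewrite /row_potential.
have [l1 [l2 [-> -> _]]] := strands_cap d2 b (~~ b) (passes_pair hg hx).
rewrite /= !potential_cat /= -eg -ex; move: (shadow _ 0 l1) (rotation _ l1) => s n.
have -> : turning theta (~~ b) * (turning theta b * s + (1 - turning theta b) * g i) +
  (1 - turning theta (~~ b)) * g i = s by case: (b); rewrite /=; field.
by case: (b) => /=; rewrite ?subrK ?addrK; ring.
Qed.

End DualStep.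

(** * Representing functionals on rows by charges, one slice downwards *)

Section DualRow.
Variables (K : fieldType) (theta : K).
Hypotheses (theta_neq0 : theta != 0) (theta_neq1 : theta != 1).

(* Transport of a functional on colorings across a slice, where each crossing
   contributes its relation with coefficient [y]. *)
Definition transport (a : slice) (d : seq bool) (y : K)
    (R : (nat -> K) -> K -> Prop) (x' : nat -> K) (v' : K) : Prop :=
  exists x v, [/\ R x v, joins a x x' &
    v' = v + (if is_cross a then y * row_relation a d theta x x' else 0)].

(** [R] is a linear subspace of pairs, that is, a partial and possibly multivalued linear
    functional. *)
Definition affine_closed (R : (nat -> K) -> K -> Prop) : Prop :=
  R (fun=> 0) 0 /\ forall a x v x0 v0, R x v -> R x0 v0 ->
    R (fun j => x j - a * x0 j) (v - a * v0).

Lemma turning_neq1 b : 1 - turning theta b != 0.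
Proof. by case: b; rewrite subr_eq0 eq_sym ?invr_eq1. Qed.

Lemma joinsB a b (x x' x0 x0' : nat -> K) : joins a x x' -> joins a x0 x0' ->
  joins a (fun j => x j - b * x0 j) (fun j => x' j - b * x0' j).
Proof.
move=> [p1 u1 c1] [p2 u2 c2]; split=> j j' h.
- by move=> h'; rewrite (p1 _ _ h) // (p2 _ _ h).
- by rewrite (u1 _ _ h) (u2 _ _ h).
- by rewrite (c1 _ _ h) (c2 _ _ h).
Qed.

Lemma row_relationB a d tau b (x x' x0 x0' : nat -> K) :
  row_relation a d tau (fun j => x j - b * x0 j) (fun j => x' j - b * x0' j) =
  row_relation a d tau x x' - b * row_relation a d tau x0 x0'.
Proof.
rewrite /row_relation /row_lambda /row_rho /row_omega /row_end.
by case: (_ == _); rewrite /=; ring.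
Qed.

Lemma row_relation0 a d tau : row_relation a d tau (fun=> 0 : K) (fun=> 0) = 0.
Proof.
rewrite /row_relation /row_lambda /row_rho /row_omega /row_end.
by case: (_ == _); rewrite /=; ring.
Qed.

Lemma transport_affine a d y R : affine_closed R -> affine_closed (transport a d y R).
Proof.
move=> [R0 RB]; split.
  exists (fun=> 0), 0; split=> //.
  by case: ifP => _; rewrite ?row_relation0 ?mulr0 addr0.
move=> b x' v' x0' v0' [x [v [Rx jx ->]]] [x0 [v0 [Rx0 jx0 ->]]].
exists (fun j => x j - b * x0 j), (v - b * v0).
split; [exact: RB|exact: joinsB|].
by case: ifP => _; rewrite ?row_relationB; ring.
Qed.

Definition represents d (g : nat -> K) (R : (nat -> K) -> K -> Prop) : Prop :=
  forall x v, R x v -> v = row_charge theta d g x.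

(** The induction step of the downward sweep: a row [g'] representing the functional above the slice
    is continued to a row [g] representing the one below, and this forces the coefficient [y] to be
    the dual one. *)
Lemma transport_represented a d d' y R g' : step_spec a d d' -> affine_closed R ->
    represents d' g' (transport a d y R) ->
  exists g, [/\ joins a g g', represents d g R &
    is_cross a -> row_relation a d theta^-1 g g' = 0 /\ row_dual theta a d g g' = y].
Proof.
move=> h; case: h g' => {a d d'} [d1 d2 b|d1 d2 b|d1 d2 b1 b2 s] g' [R0 RB] hg'.
- have [g hg] := cup_restrict (size d1) b g'.
  (* The row with weight 1 on the two new strands and 0 elsewhere continues the zero row, so its
     charge is 0. This charge is a nonzero multiple of the difference of the two colors. *)
  have eg : g' (size d1) = g' (size d1).+1.
    have [x' [hx e0 e1]] := cup_extend (size d1) b (fun=> 0 : K) 1.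
    have [l1 [l2 [E1 E2 _]]] := strands_cup d2 (passes_pair hg hx).
    have /andP[w1 w2] : all (fun u : bool * (K * K) => u.2.2 == 0) l1 &&
        all (fun u : bool * (K * K) => u.2.2 == 0) l2.
      by rewrite -all_cat -E1 all_map; apply/allP => j _ /=.
    have : 0 = row_charge theta (d1 ++ [:: b; ~~ b] ++ d2) g' x'.
      apply: hg'; exists (fun=> 0), 0; split=> //; last by rewrite addr0.
      by split=> //= j j' /andP[/eqP -> /eqP ->]; rewrite e0 e1.
    rewrite /row_charge E2 !charge_cat /= e0 e1 !charge_weight0 //.
    move: (shadow _ 0 l1) => s /esym E; apply/eqP; rewrite -subr_eq0.
    have {}E : (1 - turning theta (~~ b)) * (g' (size d1) - g' (size d1).+1) = 0.
      by rewrite -[RHS]oppr0 -E; case: (b); rewrite /=; field.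
    by move/eqP: E; rewrite mulf_eq0 (negPf (turning_neq1 _)).
  exists g; split=> //.
    split=> //= j j' /andP[/eqP -> /eqP ->] //.
  move=> x v Rx; have [x' [hx e0 e1]] := cup_extend (size d1) b x 0.
  rewrite (hg' x' v); last first.
    exists x, v; split=> //; last by rewrite /= addr0.
    by split=> //= j j' /andP[/eqP -> /eqP ->]; rewrite e0 e1.
  by apply: row_charge_cup; rewrite ?e0 ?e1.
(* A row with different colors at the two ends does not continue across the cap, so the hypothesis
   on [g'] says nothing about it. *)
- pose bad := exists x v, R x v /\ x (size d1) != x (size d1).+1.
  have charge_eq g x v x' : passes (Cap (size d1)) g g' ->
      g (size d1) = g (size d1).+1 ->
      passes (Cap (size d1)) x x' -> x (size d1) = x (size d1).+1 -> R x v ->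
      v = row_charge theta (d1 ++ [:: b; ~~ b] ++ d2) g x.
    move=> hg eg hx ex Rx; rewrite (row_charge_cap theta_neq0 d2 b hg hx eg).
    rewrite ex subrr mulr0 addr0; apply: hg'; exists x, v; split=> //.
      by split=> //= j j' /andP[/eqP -> /eqP ->].
    by rewrite /= addr0.
  have join_g g : passes (Cap (size d1)) g g' -> g (size d1) = g (size d1).+1 ->
      joins (Cap (size d1)) g g'.
    by move=> hg eg; split=> //= j j' /andP[/eqP -> /eqP ->].
  have [[x0 [v0 [Rx0 neq0]]]|no_bad] := pselect bad; last first.
    (* Without such rows any common color of the two ends works; 0 is chosen. *)
    have [g [hg e0 e1]] := cap_restrict (size d1) g' 0.
    have eg : g (size d1) = g (size d1).+1 by rewrite e0.
    exists g; split=> //; first exact: join_g.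
    move=> x v Rx; have [x' hx] := cap_extend (size d1) x.
    apply: (charge_eq g x v x') => //; apply/eqP/negPn/negP => hn.
    by apply: no_bad; exists x, v.
  have [x0' hx0] := cap_extend (size d1) x0.
  pose s0 := row_shadow theta d1 g'.
  (* The equation that the charge of [x0] be [v0] is linear in the color of the cap, and [c] is its
     solution. *)
  pose c := s0 + (v0 - row_charge theta (d1 ++ d2) g' x0') /
    (x0 (size d1) - x0 (size d1).+1) / (1 - turning theta b).
  have [g [hg e0 e1]] := cap_restrict (size d1) g' c.
  have eg : g (size d1) = g (size d1).+1 by rewrite e0.
  exists g; split=> //; first exact: join_g.
  have tb := turning_neq1 b.
  have es : row_shadow theta d1 g = s0.
    rewrite /row_shadow /s0 /row_shadow; congr shadow; apply: eq_strands => j hj.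
    by rewrite (hg j j) //= hj eqxx.
  have E0 : v0 = row_charge theta (d1 ++ [:: b; ~~ b] ++ d2) g x0.
    rewrite (row_charge_cap theta_neq0 d2 b hg hx0 eg) e0 es /c.
    by field; rewrite tb subr_eq0.
  move=> x v Rx.
  (* Subtracting [q] times [x0] makes the two ends equal, so every row reduces to [x0] and a row
     that does continue. *)
  pose q := (x (size d1) - x (size d1).+1) / (x0 (size d1) - x0 (size d1).+1).
  have [x1' hx1] := cap_extend (size d1) (fun j => x j - q * x0 j).
  have := charge_eq g _ (v - q * v0) x1' hg eg hx1 _ (RB q _ _ _ _ Rx Rx0).
  rewrite row_chargeB -E0 => E; apply: (addIr (- (q * v0))); apply: E.
  by rewrite /q; field; rewrite subr_eq0.
- have ha : is_cross (Cross (size d1) s) by [].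
  set a := Cross _ _ in ha hg' *; set d := d1 ++ _.
  have hs : step_spec a d (d1 ++ [:: b2; b1] ++ d2) by constructor.
  have [g [hg eg]] := relation_restrict d g' (invr_neq0 theta_neq0) ha.
  have joinsE (x x' : nat -> K) : passes a x x' -> joins a x x' by split.
  (* Every row extends over the crossing with any relation value [r]. Taking [r = 0] shows that [g]
     represents [R]; the zero row with [r = 1] gives the coefficient. *)
  have E x v r : R x v -> v - row_charge theta d g x = (row_dual theta a d g g' - y) * r.
    move=> Rx; have [x' [hx ex]] := relation_extend d x r theta_neq0 ha.
    have e : v + y * r = row_charge theta (d1 ++ [:: b2; b1] ++ d2) g' x'.
      by apply: hg'; exists x, v; split; [|exact: joinsE|rewrite /= ex].
    have := row_charge_cross theta_neq0 ha hs hg hx eg; rewrite -e ex => e'.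
    by rewrite mulrBl -e'; ring.
  exists g; split=> [||_]; first exact: joinsE.
    by move=> x v Rx; have := E _ _ 0 Rx; rewrite mulr0 => /subr0_eq.
  split=> //; have := E _ _ 1 R0.
  by rewrite row_charge0 subrr mulr1 => /esym/subr0_eq.
Qed.

End DualRow.

(** * Labels of arcs as consistent families of rows *)

Section DiagramRows.
Variable D : diagram.

Lemma level_spec k : (k < size D)%N ->
  step_spec (slice_at D k) (level D k) (level D k.+1).
Proof. by move=> hk; apply/stepP/level_step. Qed.

Lemma level0 : level D 0 = [::].
Proof. by rewrite /level take0. Qed.

Lemma level_size : level D (size D) = [::].
Proof. by rewrite /level take_size diagramP. Qed.

Lemma arc_of_eq (x y : point D) : arc_step D (val x) (val y) -> arc_of x = arc_of y.
Proof.
move=> h; apply/val_inj/eqP; rewrite /= root_connect; last exact: arc_connect_sym.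
by apply: connect1; apply/orP; left.
Qed.

Lemma through_level k j j' : (k < size D)%N -> through (slice_at D k) j j' ->
  (j < size (level D k))%N = (j' < size (level D k.+1))%N.
Proof.
move=> /level_spec h; case: h j j' => [d1 d2 b|d1 d2 b|d1 d2 b1 b2 s] j j' /=;
  rewrite !size_cat /=.
- by move/eqP->; case: ifP => ?; lia.
- by move=> /orP[] /andP[? /eqP]; lia.
- by move/eqP ->; do ?case: eqP => ?; lia.
Qed.

Definition consistent (T : Type) (X : nat -> nat -> T) : Prop :=
  forall k, (k < size D)%N -> joins (slice_at D k) (X k) (X k.+1).

Definition rows_of (T : Type) (X : nat -> nat -> T) (x : arc D -> T) : Prop :=
  forall q : point D, x (arc_of q) = X (val q).1 (val q).2.

Lemma cup_ends_level k j j' : (k < size D)%N -> cup_ends (slice_at D k) j j' ->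
  (j < size (level D k.+1))%N && (j' < size (level D k.+1))%N.
Proof.
move=> /level_spec h; case: h j j' => //= d1 d2 b j j' /andP[/eqP -> /eqP ->].
by rewrite size_cat /=; lia.
Qed.

Lemma cap_ends_level k j j' : (k < size D)%N -> cap_ends (slice_at D k) j j' ->
  (j < size (level D k))%N && (j' < size (level D k))%N.
Proof.
move=> /level_spec h; case: h j j' => //= d1 d2 b j j' /andP[/eqP -> /eqP ->].
by rewrite size_cat /=; lia.
Qed.

(** Indices outside a level get the default [t]. This is consistent, as [through] never relates an
    index inside its level to one outside. *)
Lemma arc_rows (T : Type) (t : T) (x : arc D -> T) :
  exists X, consistent X /\ rows_of X x.
Proof.
pose X k j := if insub (k, j) is Some q then x (arc_of (q : point D)) else t.
have XE (q : point D) : X (val q).1 (val q).2 = x (arc_of q).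
  by rewrite /X -surjective_pairing valK.
have Xout k j : (k, j) \notin points D -> X k j = t by move=> h; rewrite /X insubN.
have Xadj k j k' j' : (k, j) \in points D -> (k', j') \in points D ->
    arc_step D (k, j) (k', j') -> X k j = X k' j'.
  move=> h h' hs; have := XE (SeqSub h); have := XE (SeqSub h').
  by rewrite /= => -> ->; congr x; apply: arc_of_eq.
exists X; split=> // k hk; split=> j j' h.
- move=> hu; have := through_level hk h.
  case: (boolP ((k, j) \in points D)) => [hp|hp]; move: (hp); rewrite mem_points ltnW //= => hj.
    rewrite hj => /esym hj'; apply: Xadj => //; first by rewrite mem_points hk.
    by rewrite /arc_step /pass /= eqxx h hu orbT.
  by rewrite (negPf hj) => /esym/negbT hj'; rewrite !Xout // mem_points hk.
- have /andP[hj hj'] := cup_ends_level hk h.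
  by apply: Xadj; rewrite ?mem_points ?hk // /arc_step /turn /= eqxx h orbT.
- have /andP[hj hj'] := cap_ends_level hk h.
  by apply: Xadj; rewrite ?mem_points ?(ltnW hk) // /arc_step /turn /= eqxx h.
Qed.

(** Consistent labels are constant on the classes of [arc_adj], so an arc can take the label of its
    representative point. *)
Lemma rows_arc (T : Type) (X : nat -> nat -> T) :
  consistent X -> exists x : arc D -> T, rows_of X x.
Proof.
move=> hX; pose V (q : point D) := X (val q).1 (val q).2.
have Vstep (q q' : point D) : arc_step D (val q) (val q') -> V q = V q'.
  case: q q' => [[k j] hq] [[k' j'] hq']; rewrite /V /arc_step /turn /pass /=.
  move: hq hq'; rewrite !mem_points => /andP[hk hj] /andP[hk' hj'].
  case/orP=> [/andP[/eqP e /orP[h|/andP[k_gt0 h]]]|/andP[/andP[/eqP e h] hu]].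
  - rewrite -e; apply: (let: And3 _ _ c := hX _ _ in c) => //.
    (* The last level has no strands, hence there is a slice above level [k]. *)
    rewrite ltn_neqAle hk andbT; apply: contraL hj => /eqP ->.
    by rewrite level_size.
  - rewrite -e -(prednK k_gt0); apply: (let: And3 _ c _ := hX _ _ in c) => //.
    by rewrite prednK.
  - by rewrite e; apply: (let: And3 c _ _ := hX _ _ in c) => //; rewrite -e.
have Vconn (q q' : point D) : connect (@arc_adj D) q q' -> V q = V q'.
  case/connectP=> r; elim: r q => [|u r IH] q /=; first by move=> _ ->.
  case/andP=> /orP hu hr e; rewrite -(IH u hr e).
  by case: hu => /Vstep.
exists (fun a => V (val a)) => q; apply/esym/Vconn.
exact: connect_root.
Qed.

Section CrossingRows.
Variables (T : Type) (X : nat -> nat -> T) (x : arc D -> T).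
Hypothesis hx : rows_of X x.
Variable c : crossing D.

Local Notation k := (nat_of_ord (val c)).
Local Notation a := (slice_at D k).

Lemma omega_row : x (omega c) = row_omega a (X k).
Proof. by rewrite hx /= addn0. Qed.

Lemma lambda_row : x (lambda c) = row_lambda a (level D k) (X k) (X k.+1).
Proof.
rewrite hx /row_lambda /row_end /=.
by rewrite -[row_up _ _]/(over_up c); case: (_ == _); rewrite ?addn0 ?addn1.
Qed.

Lemma rho_row : x (rho c) = row_rho a (level D k) (X k) (X k.+1).
Proof.
rewrite hx /row_rho /row_end /=.
by rewrite -[row_up _ _]/(over_up c); case: (_ != _); rewrite ?addn0 ?addn1.
Qed.

End CrossingRows.

Lemma sum_crossing (V : nmodType) (P : nat -> V) :
  \sum_(c : crossing D) P (val (val c)) =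
  \sum_(k < size D) (if is_cross (slice_at D k) then P k else 0).
Proof.
rewrite -big_mkcond /= (reindex_omap (val : crossing D -> _) insub) => [|i hi].
  by apply/eq_bigl => c; rewrite valK eqxx (valP c).
by rewrite insubT.
Qed.

End DiagramRows.

(** * Duality between syzygies at theta and colorings at its inverse *)

Section Duality.
Variables (D : diagram) (K : fieldType) (theta : K).
Hypotheses (theta_neq0 : theta != 0) (theta_neq1 : theta != 1).

Definition relation_value (tau : K) (x : arc D -> K) (c : crossing D) : K :=
  x (lambda c) - (tau * x (rho c) + (1 - tau) * x (omega c)).

Definition coloring tau x : Prop := forall c, relation_value tau x c = 0.

(** Testing on all labels [x], not only on colorings, expresses a linear dependency of the relations
    themselves. *)
Definition syzygy (y : crossing D -> K) : Prop :=
  forall x, \sum_c y c * relation_value theta x c = 0.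

(** The form [eta] without its constant factor and without the conjugation of [g]. *)
Definition linking (f g : arc D -> K) : K :=
  \sum_c (sign c)%:~R * (f (rho c) * g (omega c) - f (omega c) * g (rho c)).

Definition syzygy_pairing (y : crossing D -> K) (f : arc D -> K) : K :=
  \sum_c y c * (f (rho c) - f (omega c)).

Local Notation relation_at tau k X :=
  (row_relation (slice_at D k) (level D k) tau (X k) (X k.+1)).

Local Notation dual_at k G :=
  (row_dual theta (slice_at D k) (level D k) (G k) (G k.+1)).

Lemma relation_row tau X x c : rows_of X x ->
  relation_value tau x c = relation_at tau (val (val c)) X.
Proof.
by move=> hx; rewrite /relation_value (lambda_row hx) (rho_row hx) (omega_row hx).
Qed.

Lemma charge_step X G k : (k < size D)%N -> consistent D X -> consistent D G ->
    (is_cross (slice_at D k) -> relation_at theta^-1 k G = 0) ->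
  row_charge theta (level D k.+1) (G k.+1) (X k.+1) -
    row_charge theta (level D k) (G k) (X k) =
  if is_cross (slice_at D k) then dual_at k G * relation_at theta k X else 0.
Proof.
move=> hk /(_ k hk) hX /(_ k hk) hG; have h := level_spec hk.
case: ifP => [ha /(_ isT) eG|ha _].
  have [[pX _ _] [pG _ _]] := (hX, hG).
  exact: row_charge_cross.
case: h ha hX hG => [d1 d2 b|d1 d2 b|//] _ [pX uX cX] [pG uG cG].
  rewrite (row_charge_cup theta_neq0 d2 pG pX) ?subrr //.
    by apply: uG; rewrite /= !eqxx.
  by apply: uX; rewrite /= !eqxx.
rewrite (row_charge_cap theta_neq0 d2 b pG pX); last by apply: cG; rewrite /= !eqxx.
by rewrite (cX (size d1) (size d1).+1) /= ?eqxx // subrr mulr0 addr0 subrr.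
Qed.

Lemma potential_step F G k : (k < size D)%N -> consistent D F -> consistent D G ->
    (is_cross (slice_at D k) -> relation_at theta^-1 k G = 0) ->
    (is_cross (slice_at D k) -> relation_at theta k F = 0) ->
  row_potential theta (level D k.+1) (G k.+1) (F k.+1) -
    row_potential theta (level D k) (G k) (F k) =
  if is_cross (slice_at D k) then
    (row_sign (slice_at D k) (level D k))%:~R *
      (row_rho (slice_at D k) (level D k) (F k) (F k.+1) *
         row_omega (slice_at D k) (G k) -
       row_omega (slice_at D k) (F k) *
         row_rho (slice_at D k) (level D k) (G k) (G k.+1)) +
    theta * (dual_at k G *
      (row_rho (slice_at D k) (level D k) (F k) (F k.+1) -
       row_omega (slice_at D k) (F k)))
  else 0.
Proof.
move=> hk /(_ k hk) hF /(_ k hk) hG; have h := level_spec hk.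
case: ifP => [ha /(_ isT) eG /(_ isT) eF|ha _ _].
  have [[pF _ _] [pG _ _]] := (hF, hG).
  exact: row_potential_cross.
case: h ha hF hG => [d1 d2 b|d1 d2 b|//] _ [pF uF cF] [pG uG cG].
  rewrite (row_potential_cup theta_neq0 d2 pG pF) ?subrr //.
    by apply: uG; rewrite /= !eqxx.
  by apply: uF; rewrite /= !eqxx.
rewrite (row_potential_cap theta_neq0 d2 b pG pF) ?subrr //.
  by apply: cG; rewrite /= !eqxx.
by apply: cF; rewrite /= !eqxx.
Qed.

Lemma telescope (P : nat -> K) :
  \sum_(k < size D) (P k.+1 - P k) = P (size D) - P 0%N.
Proof. by rewrite -(big_mkord xpredT (fun k => P k.+1 - P k)) telescope_sumr. Qed.

(** The weighted relations are the increments of the charge, which vanishes on the empty bottom and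
    top levels. *)
Lemma dual_syzygy G (y : crossing D -> K) : consistent D G ->
    (forall k, (k < size D)%N -> is_cross (slice_at D k) ->
       relation_at theta^-1 k G = 0) ->
    (forall c, y c = dual_at (val (val c)) G) ->
  syzygy y.
Proof.
move=> hG eG ey x; have [X [hX hx]] := arc_rows 0 x.
under eq_bigr => c _ do rewrite ey (relation_row _ c hx).
rewrite (sum_crossing D (fun k => dual_at k G * relation_at theta k X)).
rewrite (eq_bigr _ (fun k _ => esym (charge_step (ltn_ord k) hX hG (eG _ (ltn_ord k))))).
rewrite (telescope (fun k => row_charge theta (level D k) (G k) (X k))).
by rewrite level0 level_size subrr.
Qed.

Lemma linking_dual G g f (y : crossing D -> K) : consistent D G -> rows_of G g ->
    coloring theta^-1 g -> coloring theta f ->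
    (forall c, y c = dual_at (val (val c)) G) ->
  linking f g + theta * syzygy_pairing y f = 0.
Proof.
move=> hG hg cg cf ey; have [F [hF hf]] := arc_rows 0 f.
have rel0 tau X x k : rows_of X x -> coloring tau x -> (k < size D)%N ->
    is_cross (slice_at D k) -> relation_at tau k X = 0.
  move=> hx cx hk ha; pose c : crossing D := exist _ (Ordinal hk) ha.
  by have := cx c; rewrite (relation_row _ c hx).
rewrite /linking /syzygy_pairing mulr_sumr -big_split /=.
under eq_bigr => c _ do
  rewrite ey (rho_row hf) (rho_row hg) (omega_row hf) (omega_row hg)
    -[sign c]/(row_sign (slice_at D (val (val c))) (level D (val (val c)))).
rewrite (sum_crossing D (fun k =>
    (row_sign (slice_at D k) (level D k))%:~R *
      (row_rho (slice_at D k) (level D k) (F k) (F k.+1) *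
         row_omega (slice_at D k) (G k) -
       row_omega (slice_at D k) (F k) *
         row_rho (slice_at D k) (level D k) (G k) (G k.+1)) +
    theta * (dual_at k G *
      (row_rho (slice_at D k) (level D k) (F k) (F k.+1) -
       row_omega (slice_at D k) (F k))))).
rewrite (eq_bigr _ (fun k _ => esym (potential_step (ltn_ord k) hF hG
  (rel0 _ _ _ _ hg cg (ltn_ord k)) (rel0 _ _ _ _ hf cf (ltn_ord k))))).
rewrite (telescope (fun k => row_potential theta (level D k) (G k) (F k))).
by rewrite level0 level_size subrr.
Qed.

Section DualColoring.
Variable y : crossing D -> K.

(** [y] is extended by 0 to all indices, so that recursion over levels carries no membership
    proofs. *)
Definition coefficient (k : nat) : K :=
  oapp y 0 (obind insub (insub k : option 'I_(size D))).

Lemma coefficientE c : coefficient (val (val c)) = y c.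
Proof. by rewrite /coefficient valK /= valK. Qed.

(* [reachable k x v]: some coloring of the part of the diagram below level [k],
   with colors [x] at that level, has weighted sum of relations [v]. *)
Fixpoint reachable (k : nat) : (nat -> K) -> K -> Prop :=
  if k is k'.+1 then
    transport theta (slice_at D k') (level D k') (coefficient k') (reachable k')
  else fun _ v => v = 0.

Lemma reachable_affine k : affine_closed (reachable k).
Proof.
elim: k => [|k IH] /=; last exact: transport_affine.
by split=> // a _ _ _ _ -> ->; rewrite mulr0 subr0.
Qed.

Lemma reachable_rows k x v : reachable k x v ->
  exists X : nat -> nat -> K, [/\ X k = x,
    forall l, (l < k)%N -> joins (slice_at D l) (X l) (X l.+1) &
    v = \sum_(l < k) (if is_cross (slice_at D l) then
                        coefficient l * relation_at theta l X else 0)].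
Proof.
elim: k x v => [|k IH] x v /=; first by move=> ->; exists (fun=> x); rewrite big_ord0.
case=> x0 [v0 [/IH [X [<- hX ->]] hj ->]].
(* Levels up to [k] keep the rows found before; [x] is the new row at level [k.+1]. *)
exists (fun l => if (l <= k)%N then X l else x); split=> [|l|].
- by rewrite ltnn.
- by rewrite ltnS => hl; rewrite hl; case: ltngtP hl => // [/hX|->].
rewrite big_ord_recr /= leqnn ltnn; congr (_ + _).
by apply: eq_bigr => l _; rewrite (ltnW (ltn_ord l)) ltn_ord.
Qed.

(** At the top, the rows assemble to a labelling of all arcs, to which the syzygy applies. *)
Lemma syzygy_reachable x v : syzygy y -> reachable (size D) x v -> v = 0.
Proof.
move=> hy /reachable_rows[X [_ hX ->]]; have [z hz] := rows_arc hX.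
rewrite -(sum_crossing D (fun l => coefficient l * relation_at theta l X)) -[RHS](hy z).
by apply: eq_bigr => c _; rewrite coefficientE (relation_row _ c hz).
Qed.

(** The sweep runs from the top. Its invariant is that the charge of the current row represents all
    weighted sums of relations below it. *)
Lemma syzygy_dual : syzygy y -> exists G, [/\ consistent D G,
  forall k, (k < size D)%N -> is_cross (slice_at D k) -> relation_at theta^-1 k G = 0 &
  forall c, y c = dual_at (val (val c)) G].
Proof.
move=> hy.
suff down m : (m <= size D)%N -> exists G : nat -> nat -> K,
    (forall k, (size D - m <= k < size D)%N ->
       joins (slice_at D k) (G k) (G k.+1) /\
       (is_cross (slice_at D k) ->
        relation_at theta^-1 k G = 0 /\ dual_at k G = coefficient k)) /\
    represents theta (level D (size D - m)) (G (size D - m)%N)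
      (reachable (size D - m)).
  have [G [hG _]] := down _ (leqnn _); exists G; split=> [k hk|k hk ha|c].
  - by have [] := hG k; rewrite ?subnn.
  - by have [|_ /(_ ha) []] := hG k; rewrite ?subnn.
  - have [|_ /(_ (valP c)) [_ ->]] := hG (val (val c)); last by rewrite coefficientE.
    by rewrite subnn /=.
elim: m => [|m IH] hm.
  (* At the top level the charge is an empty sum, and the syzygy makes all reachable values 0. *)
  exists (fun _ _ => 0); split=> [k|x v]; first by lia.
  by rewrite subn0 => /(syzygy_reachable hy) ->; rewrite level_size.
have [G [hG]] := IH (ltnW hm); set k := (size D - m.+1)%N.
have -> : (size D - m = k.+1)%N by rewrite /k; lia.
have hk : (k < size D)%N by rewrite /k; lia.
move=> rG; have [g [jg rg eg]] :=
  transport_represented theta_neq0 theta_neq1 (level_spec hk) (reachable_affine k) rG.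
exists (fun l => if (l <= k)%N then g else G l); split; last by rewrite leqnn.
move=> l /andP[]; rewrite leq_eqVlt => /orP[/eqP <- _|hl hl'].
  by rewrite leqnn ltnn.
rewrite leqNgt hl leqNgt (ltnW hl : (k < l.+1)%N) /=; apply: hG.
by rewrite hl' andbT /k; move: hl; rewrite /k; lia.
Qed.

End DualColoring.

Lemma dual_colorings f : coloring theta f ->
  (forall y, syzygy y -> syzygy_pairing y f = 0) <->
  (forall g, coloring theta^-1 g -> linking f g = 0).
Proof.
move=> hf; split=> [h g hg|h y hy].
  have [G [hG hg']] := arc_rows 0 g.
  pose y (c : crossing D) := dual_at (val (val c)) G.
  have := linking_dual hG hg' hg hf (fun=> erefl : y _ = _).
  rewrite (h y) ?mulr0 ?addr0 //; apply: (dual_syzygy hG) => // k hk ha.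
  by have := hg (exist _ (Ordinal hk) ha); rewrite (relation_row _ _ hg').
have [G [hG eG ey]] := syzygy_dual hy; have [g hg] := rows_arc hG.
have cg : coloring theta^-1 g.
  by move=> c; rewrite (relation_row _ c hg); exact: eG (ltn_ord (val c)) (valP c).
have /eqP := linking_dual hG hg cg hf ey.
by rewrite h // add0r mulf_eq0 (negPf theta_neq0) => /eqP.
Qed.

End Duality.

(** * Alexander relations as polynomials and their values at theta *)

Section AlexanderColoring.
Variables (D : diagram) (F : fieldType) (E : fieldExtType F) (theta : E).

Local Notation value q := ((map_poly (in_alg E) q).[theta]).

Definition relation_poly (c : crossing D) (a : arc D) : {poly F} :=
  (a == lambda c)%:R - ('X * (a == rho c)%:R + (1 - 'X) * (a == omega c)%:R).

Lemma valueM q r : value (q * r) = value q * value r.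
Proof. by rewrite rmorphM hornerM. Qed.

Lemma value_sum (I : finType) (q : I -> {poly F}) :
  value (\sum_i q i) = \sum_i value (q i).
Proof. by rewrite rmorph_sum horner_sum. Qed.

Lemma sum_delta (x : arc D -> E) b : \sum_a (a == b)%:R * x a = x b.
Proof.
rewrite (bigD1 b) //= eqxx mul1r big1 ?addr0 // => a /negPf ->.
by rewrite mul0r.
Qed.

Lemma sum_relation_poly (x : arc D -> E) c :
  \sum_a value (relation_poly c a) * x a = relation_value theta x c.
Proof.
rewrite /relation_value -(sum_delta x (lambda c)) -(sum_delta x (rho c)).
rewrite -(sum_delta x (omega c)) !mulr_sumr -big_split -sumrB /=.
apply: eq_bigr => a _; rewrite /relation_poly.
rewrite !(rmorphB, rmorphD, rmorphM, rmorph_nat, rmorph1) /= map_polyX.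
by rewrite !(hornerD, hornerN, hornerM, hornerX, hornerC, hornerMn); ring.
Qed.

(** In [lambda - (t * rho + (1 - t) * omega)] only the coefficients of [rho] and [omega] depend on
    [t]. *)
Lemma sum_relation_deriv (x : arc D -> E) c :
  \sum_a value (relation_poly c a)^`() * x a = - (x (rho c) - x (omega c)).
Proof.
rewrite -(sum_delta x (rho c)) -(sum_delta x (omega c)) opprB -sumrB /=.
apply: eq_bigr => a _; rewrite /relation_poly.
rewrite !(derivB, derivD, derivM, derivX, derivC, derivMn) /=.
rewrite !mul0rn !mulr0 !addr0 mul1r sub0r add0r mulN1r.
rewrite !(rmorphB, rmorphN, rmorphD, rmorph_nat) /=.
by rewrite !(hornerD, hornerN, hornerC, hornerMn); ring.
Qed.

Section PolynomialSyzygy.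
Variables (h : {poly F}) (V : arc D -> {poly F}) (Y : crossing D -> {poly F}).
Hypotheses (h_root : value h = 0)
  (hV : forall a, h * V a = \sum_c Y c * relation_poly c a).

(** By [hV] the combination of relations is a multiple of [h], hence vanishes at [theta]. *)
Lemma value_syzygy : syzygy theta (fun c => value (Y c)).
Proof.
move=> x; under eq_bigr => c _ do rewrite -sum_relation_poly mulr_sumr.
rewrite exchange_big big1 //= => a _.
under eq_bigr => c _ do rewrite mulrA -valueM.
by rewrite -mulr_suml -value_sum -hV valueM h_root !mul0r.
Qed.

(* Differentiating [hV] at the root [theta] of [h]. *)
Lemma value_pairing x : coloring theta x ->
  value h^`() * (\sum_a value (V a) * x a) =
  - syzygy_pairing (fun c => value (Y c)) x.
Proof.
move=> hx; rewrite mulr_sumr /syzygy_pairing -sumrN.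
have dV a : value h^`() * (value (V a) * x a) =
    \sum_c (value (Y c)^`() * (value (relation_poly c a) * x a) +
            value (Y c) * (value (relation_poly c a)^`() * x a)).
  have := congr1 (fun q => value q^`() * x a) (hV a).
  rewrite derivM rmorphD hornerD !valueM h_root mul0r addr0 -mulrA => ->.
  rewrite (raddf_sum (@deriv F)) value_sum mulr_suml; apply: eq_bigr => c _.
  by rewrite /= derivM rmorphD hornerD !valueM; ring.
under eq_bigr => a _ do rewrite dV.
rewrite exchange_big; apply: eq_bigr => c _ /=.
rewrite big_split /= -!mulr_sumr sum_relation_poly hx mulr0 add0r.
by rewrite sum_relation_deriv mulrN.
Qed.

End PolynomialSyzygy.

Lemma laurent_polyM (q r : {poly F}) : laurent_poly (q * r) = laurent_poly q * laurent_poly r.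
Proof. by apply: val_inj; rewrite /= rmorphM. Qed.

Lemma laurent_polyB (q r : {poly F}) : laurent_poly (q - r) = laurent_poly q - laurent_poly r.
Proof. by apply: val_inj; rewrite /= rmorphB. Qed.

Lemma laurent_poly_inj : injective (@laurent_poly F).
Proof. by move=> q r /(congr1 val) /= /eqP; rewrite tofrac_eq => /eqP. Qed.

Lemma laurent_poly0 : laurent_poly (0 : {poly F}) = 0.
Proof. by rewrite -(subrr 0) laurent_polyB subrr. Qed.

Lemma laurent_polyD (q r : {poly F}) : laurent_poly (q + r) = laurent_poly q + laurent_poly r.
Proof. by rewrite -{1}[r]opprK -[- r]sub0r !laurent_polyB laurent_poly0 sub0r opprK. Qed.

Lemma laurent_poly_sum (I : finType) (q : I -> {poly F}) :
  laurent_poly (\sum_i q i) = \sum_i laurent_poly (q i).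
Proof. exact: (big_morph _ laurent_polyD laurent_poly0). Qed.

Lemma laurent_polyX n : laurent_poly ('X^n : {poly F}) = laurent_t F ^+ n.
Proof.
elim: n => [|n IH]; last by rewrite !exprS laurent_polyM IH.
by apply: val_inj; rewrite /= rmorph1.
Qed.

Lemma alexander_relationE c a :
  alexander_relation F c a = laurent_poly (relation_poly c a).
Proof.
have poly_nat (b : bool) : laurent_poly (b%:R : {poly F}) = b%:R.
  by case: b; [apply: val_inj; rewrite /= rmorph1|exact: laurent_poly0].
have combE z z' (u v w : {ffun arc D -> (laurent F)^o}) :
    (u - (z *: v + z' *: w)) a = u a - (z * v a + z' * w a) by rewrite !ffunE.
have deltaE b :
    ([ffun b' => (b' == b)%:R] : {ffun arc D -> (laurent F)^o}) a = (a == b)%:R.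
  by rewrite ffunE.
have poly1 : laurent_poly (1 : {poly F}) = 1 := poly_nat true.
rewrite /alexander_relation /= [LHS]combE !deltaE.
rewrite /relation_poly laurent_polyB laurent_polyD !laurent_polyM laurent_polyB.
by rewrite !poly_nat poly1.
Qed.

Lemma clear_denominators (I : finType) (u : I -> laurent F) :
  exists n (q : I -> {poly F}), forall i, laurent_t F ^+ n * u i = laurent_poly (q i).
Proof.
have /choice[nq hnq] i : exists nq : nat * {poly F},
    laurent_t F ^+ nq.1 * u i = laurent_poly nq.2.
  have [nq /eqP e] := laurentP (u i); exists nq; apply: val_inj.
  by rewrite rmorphM rmorphXn /= mulrC.
exists (\max_i (nq i).1), (fun i => 'X^(\max_i (nq i).1 - (nq i).1) * (nq i).2) => i.
rewrite laurent_polyM -hnq laurent_polyX mulrA -exprD subnK //.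
exact: (leq_bigmax (F := fun i => (nq i).1)).
Qed.

End AlexanderColoring.

(** * Representations as colorings *)

Section Representations.
Variables (D : diagram) (p : nat) (E : fieldExtType 'F_p) (theta : E).
Variable theta_neq0 : theta != 0.

Local Notation value q := ((map_poly (in_alg E) q).[theta]).
Local Notation L := (laurent 'F_p).
Local Notation proj := (presented_proj (@alexander_relation D 'F_p)).
Local Notation eval := (laurent_eval theta).

Lemma laurent_eval_poly (q : {poly 'F_p}) : eval (laurent_poly q) = value q.
Proof.
by rewrite (@laurent_evalE _ _ _ theta_neq0 _ 0 q) ?expr0 ?divr1 ?mulr1.
Qed.

Lemma laurent_eval0 : eval 0 = 0.
Proof. by rewrite -laurent_poly0 laurent_eval_poly rmorph0 horner0. Qed.

Lemma presented_proj0 : proj 0 = 0.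
Proof. by apply: (addIr (proj 0)); rewrite -presented_projD !add0r. Qed.

Lemma presented_projZ (z : L) v : proj (z *: v) = z *: (proj v : alexander D 'F_p).
Proof. by rewrite -presented_scaleE. Qed.

Lemma presented_proj_sum (I : finType) (v : I -> {ffun arc D -> L^o}) :
  proj (\sum_i v i) = \sum_i proj (v i).
Proof. exact: (big_morph _ (@presented_projD _ _ _ _) presented_proj0). Qed.

Lemma presented_proj_eq0 v :
  (proj v == 0) = (v \in relation_span (@alexander_relation D 'F_p)).
Proof. by rewrite -[v in RHS]subr0 Quotient.idealrBE -presented_proj0. Qed.

Lemma presented_proj_gen v : proj v = \sum_a v a *: alexander_gen 'F_p a.
Proof.
rewrite {1}(_ : v = \sum_a v a *: ([ffun b => (b == a)%:R] : {ffun arc D -> L^o})).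
  by rewrite presented_proj_sum; apply: eq_bigr => a _; rewrite presented_projZ.
have key (z : L) (a b : arc D) :
    (z *: ([ffun b' => (b' == a)%:R] : {ffun arc D -> L^o})) b = z * (b == a)%:R.
  by rewrite ffunE [X in z *: X]ffunE.
apply/ffunP => b; rewrite sum_ffunE (eq_bigr _ (fun a _ => key (v a) a b)).
rewrite (bigD1 b) //= eqxx mulr1 big1 ?addr0 // => a /negPf ab.
by rewrite eq_sym ab mulr0.
Qed.

Lemma rep_proj (f : Rep D theta_neq0) v :
  f (proj v) = \sum_a eval (v a) * color f a :> E.
Proof.
by rewrite presented_proj_gen linear_sum; apply: eq_bigr => a _; rewrite linearZ.
Qed.

Lemma color_coloring (f : Rep D theta_neq0) : coloring theta (color f).
Proof.
move=> c; rewrite -sum_relation_poly.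
have e : proj (alexander_relation 'F_p c) = 0.
  apply/eqP; rewrite presented_proj_eq0; apply/asboolP.
  exists (fun c' => (c' == c)%:R); rewrite (bigD1 c) //= eqxx scale1r big1 ?addr0 //.
  by move=> c' /negPf ->; rewrite scale0r.
have := rep_proj f (alexander_relation 'F_p c); rewrite e linear0 => /esym.
by under eq_bigr => a _ do rewrite alexander_relationE laurent_eval_poly.
Qed.

Lemma coloring_rep x : coloring theta x ->
  exists f : Rep D theta_neq0, forall a, color f a = x a.
Proof.
move=> hx; pose phi (v : {ffun arc D -> L^o}) : E :=
  \sum_a eval (v a) * x a.
have phiD u v : phi (u + v) = phi u + phi v.
  rewrite /phi -big_split; apply: eq_bigr => a _.
  by rewrite ffunE laurent_evalD // mulrDl.
have phiZ z v : phi (z *: v) = eval z * phi v.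
  rewrite /phi [RHS]mulr_sumr; apply: eq_bigr => a _.
  by rewrite (_ : (z *: v) a = z * v a) ?laurent_evalM ?mulrA // ffunE.
have phi0 : phi 0 = 0 by rewrite -(scale0r 0) phiZ laurent_eval0 mul0r.
have phiB u v : phi u - phi v = phi (u - v).
  by apply/esym/(canRL (addrK (phi v))); rewrite -phiD (subrK v u).
have phi_rel v : v \in relation_span (@alexander_relation D 'F_p) -> phi v = 0.
  move/asboolP => [z ->].
  transitivity (\sum_c phi (z c *: alexander_relation 'F_p c)).
    exact: (big_morph phi phiD phi0).
  apply: big1 => c _; rewrite phiZ.
  suff -> : phi (alexander_relation 'F_p c) = 0 by rewrite mulr0.
  rewrite -[RHS](hx c) -sum_relation_poly.
  by apply: eq_bigr => a _; rewrite alexander_relationE laurent_eval_poly.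
(* [phi] is evaluated at a chosen representative; [phi_rel] makes the choice immaterial. *)
pose f (q : alexander D 'F_p) : theta_module theta_neq0 := phi (repr q).
have fE v : f (proj v) = phi v.
  have h : repr (proj v : Quotient.quot (relation_span (@alexander_relation D 'F_p))) - v \in
      relation_span (@alexander_relation D 'F_p).
    by rewrite Quotient.idealrBE reprK.
  by have := phi_rel _ h; rewrite -phiB => /subr0_eq.
have f_linear : linear f.
  move=> z; elim/presentedW => u; elim/presentedW => v.
  by rewrite -presented_projZ -presented_projD fE phiD phiZ -2!fE.
pose fl := GRing.isLinear.Build _ _ _ _ f f_linear.
pose g : Rep D theta_neq0 := HB.pack f fl.
exists g => a; rewrite /color /= fE /phi -[RHS](sum_delta x a).
apply: eq_bigr => b _; rewrite ffunE; congr (_ * _).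
by case: (_ == _); rewrite ?laurent_eval0 ?laurent_eval1.
Qed.

End Representations.

(** * The annihilator of the torsion in terms of syzygies *)

Section Annihilator.
Variables (D : diagram) (p : nat) (E : fieldExtType 'F_p) (theta : E).
Variables (theta_neq0 : theta != 0) (h : {poly 'F_p}).

Local Notation value q := ((map_poly (in_alg E) q).[theta]).
Local Notation L := (laurent 'F_p).
Local Notation proj := (presented_proj (@alexander_relation D 'F_p)).

Hypotheses (value_surj : forall e, exists q : {poly 'F_p}, value q = e)
  (h_min : forall q : {poly 'F_p}, value q = 0 -> h %| q)
  (h_root : value h = 0) (h_sep : value h^`() != 0).

(** Multiplying by a power of [t] turns the Laurent identity into one of polynomials, which can then
    be differentiated. *)
Lemma span_poly n (V : arc D -> {poly 'F_p}) (Y : crossing D -> {poly 'F_p})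
    (v : {ffun arc D -> L^o}) (z : crossing D -> L) :
    (forall a, laurent_t 'F_p ^+ n * v a = laurent_poly (V a)) ->
    (forall c, laurent_t 'F_p ^+ n * z c = laurent_poly (Y c)) ->
    laurent_poly h *: v = \sum_c z c *: alexander_relation 'F_p c ->
  forall a, h * V a = \sum_c Y c * relation_poly 'F_p c a.
Proof.
move=> hV hY e a; apply: laurent_poly_inj.
have {}e : laurent_poly h * v a = \sum_c z c * laurent_poly (relation_poly 'F_p c a).
  have := congr1 (fun u : {ffun arc D -> L^o} => u a) e; rewrite sum_ffunE ffunE => {}e.
  rewrite [LHS]e; apply: eq_bigr => c _.
  by rewrite -alexander_relationE ffunE.
rewrite laurent_polyM -hV mulrCA e laurent_poly_sum mulr_sumr.
by apply: eq_bigr => c _; rewrite laurent_polyM -hY mulrA.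
Qed.

Lemma poly_span (V : arc D -> {poly 'F_p}) (Y : crossing D -> {poly 'F_p}) :
    (forall a, h * V a = \sum_c Y c * relation_poly 'F_p c a) ->
  laurent_poly h *: ([ffun a => laurent_poly (V a)] : {ffun arc D -> L^o}) =
  \sum_c laurent_poly (Y c) *: alexander_relation 'F_p c.
Proof.
move=> hV; apply/ffunP => a.
have scaleE (z : L) (u : {ffun arc D -> L^o}) : (z *: u) a = z * u a by rewrite ffunE.
rewrite [LHS]scaleE ffunE -laurent_polyM hV laurent_poly_sum [RHS]sum_ffunE.
apply: eq_bigr => c _.
by rewrite [RHS]scaleE alexander_relationE laurent_polyM.
Qed.

(** An identity between [h * V] and a combination of relations with coefficients [Y] makes [V] a
    torsion element and the values of [Y] a syzygy; [value_pairing] compares [f] on the former with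
    the pairing of the latter. *)
Lemma Rep'_syzygy (f : Rep D theta_neq0) : Rep' D theta_neq0 h f <->
  forall y, syzygy theta y -> syzygy_pairing y (color f) = 0.
Proof.
have hf := color_coloring f; split=> [hR y hy|hy q].
  (* The syzygy is lifted to polynomials. The combination of relations then vanishes at [theta], so
     [h] divides its entries, and the quotients [V] form a torsion element. *)
  have [Y hY] := choice (fun c => value_surj (y c)).
  have W_eq0 a : value (\sum_c Y c * relation_poly 'F_p c a) = 0.
    rewrite -[RHS](hy (fun b => (b == a)%:R)) value_sum; apply: eq_bigr => c _.
    rewrite valueM hY -sum_relation_poly; congr (_ * _).
    rewrite (bigD1 a) //= eqxx mulr1 big1 ?addr0 // => b /negPf ->.
    by rewrite mulr0.
  have /choice[V hV] a : exists V, h * V = \sum_c Y c * relation_poly 'F_p c a.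
    by have /dvdpP[V ->] := h_min (W_eq0 a); exists V; rewrite mulrC.
  have := value_pairing h_root hV hf.
  have -> : \sum_a value (V a) * color f a = 0.
    transitivity (f (proj [ffun a => laurent_poly (V a)]) : E).
      rewrite rep_proj; apply: eq_bigr => a _.
      by rewrite ffunE laurent_eval_poly.
    apply: hR; rewrite /alexander_torsion /= -presented_projZ (poly_span hV).
    apply/eqP; rewrite presented_proj_eq0; apply/asboolP.
    by exists (fun c => laurent_poly (Y c)).
  rewrite mulr0 => /esym/eqP; rewrite oppr_eq0 => /eqP <-.
  by apply: eq_bigr => c _; rewrite hY.
elim/presentedW: q => v /= hv.
have /asboolP[z hz] : laurent_poly h *: v \in relation_span (@alexander_relation D 'F_p).
  by rewrite -presented_proj_eq0 presented_projZ; apply/eqP.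
(* A single power of [t] serves both [v] and the coefficients [z]. *)
have [n [U hU]] := clear_denominators
  (fun s : arc D + crossing D => match s with inl a => v a | inr c => z c end).
pose V a := U (inl a); pose Y c := U (inr c).
have hV := span_poly (fun a => hU (inl a)) (fun c => hU (inr c)) hz.
have := value_pairing h_root hV hf.
rewrite (hy _ (value_syzygy h_root hV)) oppr0 => /eqP.
rewrite mulf_eq0 (negPf h_sep) /= => /eqP e.
(* Clearing denominators has multiplied the value of [f] by the nonzero factor [theta ^+ n]. *)
have : theta ^+ n * \sum_a laurent_eval theta (v a) * color f a = 0.
  rewrite -[RHS]e mulr_sumr; apply: eq_bigr => a _; rewrite mulrA; congr (_ * _).
  rewrite -laurent_eval_poly // -hU laurent_evalM // -laurent_polyX laurent_eval_poly //.
  by rewrite map_polyXn hornerXn.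
move/eqP; rewrite mulf_eq0 expf_eq0 (negPf theta_neq0) andbF /= => /eqP e'.
by rewrite -[RHS]e' -rep_proj.
Qed.

End Annihilator.

(** * Conjugation and the radical of the Hermitian form *)

Section Conjugation.
Variables (p : nat) (p_prime : prime p) (E : fieldExtType 'F_p).

Lemma pcharE : p \in [pchar E].
Proof. by rewrite pchar_lalg pchar_Fp. Qed.

Lemma conjE (x : E) : conj x = pFrobenius_aut pcharE x.
Proof. by rewrite pFrobenius_autE. Qed.

Lemma conjM : {morph @conj p E : x y / x * y}.
Proof. by move=> x y; rewrite !conjE rmorphM. Qed.

Lemma conjB : {morph @conj p E : x y / x - y}.
Proof. by move=> x y; rewrite !conjE rmorphB. Qed.

Lemma conj0 : conj (0 : E) = 0.
Proof. by rewrite conjE rmorph0. Qed.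

Lemma conjD : {morph @conj p E : x y / x + y}.
Proof. by move=> x y; rewrite !conjE rmorphD. Qed.

Lemma conj1 : conj (1 : E) = 1.
Proof. by rewrite conjE rmorph1. Qed.

Lemma conj_int (z : int) : conj (z%:~R : E) = z%:~R.
Proof. by rewrite conjE rmorph_int. Qed.

Lemma conj_horner (q : {poly 'F_p}) (x : E) :
  conj (map_poly (in_alg E) q).[x] = (map_poly (in_alg E) q).[conj x].
Proof.
rewrite !conjE -horner_map -map_poly_comp; congr _.[_].
apply: eq_map_poly => c /=.
have fermat : c ^+ p = c by have := expf_card c; rewrite card_Fp.
by rewrite -conjE /conj exprZn expr1n fermat.
Qed.

Variables (D : diagram) (theta : E).

Lemma conj_coloring tau (x : arc D -> E) :
  coloring tau x -> coloring (conj tau) (fun a => conj (x a)).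
Proof.
move=> hx c; rewrite -conj0 -(hx c) /relation_value conjB conjD !conjM conjB.
by rewrite conj1.
Qed.

Hypothesis conjK : forall x : E, conj (conj x) = x.

(** [linking] is antisymmetric and has integer coefficients. *)
Lemma conj_linking (x y : arc D -> E) :
  conj (linking x (fun a => conj (y a))) = - linking y (fun a => conj (x a)).
Proof.
rewrite /linking -sumrN (big_morph _ conjD conj0); apply: eq_bigr => c _.
by rewrite conjM conj_int conjB !conjM !conjK; ring.
Qed.

Variables (theta_neq0 : theta != 0) (i : E).

Lemma eta_linking (f g : Rep D theta_neq0) :
  eta i f g = i * linking (color f) (fun a => conj (color g a)).
Proof.
rewrite [RHS]mulr_sumr.
apply: eq_bigr => c _.
by rewrite mulrA [i * _]mulrC.
Qed.

Hypotheses (i_neq0 : i != 0) (conj_theta : conj theta = theta^-1).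

(** Conjugation maps the colorings at [theta] onto those at [theta^-1], and [conj_linking] moves [g]
    to the first argument. *)
Lemma rad_eta_linking (g : Rep D theta_neq0) : rad_eta D theta_neq0 i g <->
  forall x, coloring theta^-1 x -> linking (color g) x = 0.
Proof.
have linkE x : (linking x (fun a => conj (color g a)) == 0) =
    (linking (color g) (fun a => conj (x a)) == 0).
  rewrite -[RHS]oppr_eq0 -conj_linking.
  by apply/eqP/eqP => [->|e]; [exact: conj0|rewrite -[LHS]conjK e conj0].
split=> [hg x hx|hg f].
  have hx' : coloring theta (fun a => conj (x a)).
    by rewrite -[theta]conjK conj_theta; apply: conj_coloring.
  have [f hf] := coloring_rep theta_neq0 hx'.
  have := hg f; rewrite eta_linking => /eqP.
  rewrite mulf_eq0 (negPf i_neq0) /= linkE => /eqP <-.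
  by congr linking; apply: funext => a; rewrite hf conjK.
apply/eqP; rewrite eta_linking mulf_eq0 linkE hg ?eqxx ?orbT //.
by rewrite -conj_theta; apply/conj_coloring/color_coloring.
Qed.

End Conjugation.

Theorem theorem5p7 (p : nat) (p_prime : prime p)
    (E : fieldExtType 'F_p) (dimE : \dim {: E} = 2%N)
    (theta : E) (theta_gen : <<1; theta>>%VS = {: E}%VS)
    (theta_norm : theta * conj theta = 1)
    (kappa : 'F_p)
    (kappaE : minPoly 1 theta = map_poly (in_alg E) ('X^2 + kappa *: 'X + 1))
    (i : E) (i_neq0 : i != 0) (i_conj : conj i = - i)
    (D : diagram) (D_two_bridge : two_bridge_knot D) :
  rad_eta D (norm1_neq0 theta_norm) i =
  Rep' D (norm1_neq0 theta_norm) ('X^2 + kappa *: 'X + 1).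
Proof.
set h := 'X^2 + kappa *: 'X + 1.
move: (norm1_neq0 theta_norm) => theta_neq0.
have conj_theta : conj theta = theta^-1.
  by apply: (mulfI theta_neq0); rewrite theta_norm divff.
have value_surj (e : E) : exists q : {poly 'F_p}, (map_poly (in_alg E) q).[theta] = e.
  have /Fadjoin_polyP[q /polyOver1P[r ->] ->] : e \in <<1; theta>>%VS.
    by rewrite theta_gen memvf.
  by exists r.
(* Each element is a polynomial in [theta] over the prime field, and two conjugations fix
   [theta]. *)
have conjK (x : E) : conj (conj x) = x.
  have [q <-] := value_surj x.
  by rewrite !conj_horner // conj_theta /conj exprVn -/(conj theta) conj_theta invrK.
have h_root : (map_poly (in_alg E) h).[theta] = 0.
  by apply/eqP; rewrite -kappaE; apply: root_minPoly.
have h_min (q : {poly 'F_p}) : (map_poly (in_alg E) q).[theta] = 0 -> h %| q.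
  move=> hq; rewrite -(dvdp_map (in_alg E)) -kappaE; apply: minPoly_dvdp.
    by apply/polyOver1P; exists q.
  exact/eqP.
have theta_notin1 : theta \notin 1%VS.
  apply/negP => /Fadjoin_idP e; move: dimE; rewrite -theta_gen.
  by rewrite [<<1; theta>>%VS]e dimv1.
have theta_neq1 : theta != 1 by apply: contra theta_notin1 => /eqP ->; apply: mem1v.
have h_sep : (map_poly (in_alg E) h^`()).[theta] != 0.
  apply: contra theta_notin1 => /eqP; move: h_root; rewrite /h.
  rewrite !(derivD, derivXn, derivZ, derivX, derivC) !rmorphD /= !map_polyZ /=.
  rewrite !(map_polyXn, map_polyX, rmorph1, rmorph0) addr0.
  rewrite !(hornerD, hornerXn, hornerZ, hornerX, hornerC).
  (* Since [theta * h'(theta) - h(theta) = theta ^+ 2 - 1], a double root would be 1 or -1, hence in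
     the prime field. *)
  move=> e1 e2; have /eqP : (theta - 1) * (theta + 1) = 0.
    transitivity (theta * (theta + theta + kappa%:A * 1) -
      (theta ^+ 2 + kappa%:A * theta + 1)); first by ring.
    by rewrite e1 e2 mulr0 subr0.
  rewrite mulf_eq0 subr_eq0 addr_eq0 => /orP[] /eqP ->; first exact: mem1v.
  by rewrite rpredN mem1v.
apply/seteqP; split=> f.
  move/(rad_eta_linking p_prime conjK i_neq0 conj_theta) => hf.
  apply/(Rep'_syzygy value_surj h_min h_root h_sep).
  exact/(dual_colorings theta_neq0 theta_neq1 (color_coloring f)).
move/(Rep'_syzygy value_surj h_min h_root h_sep) => hf.
apply/(rad_eta_linking p_prime conjK i_neq0 conj_theta).
exact/(dual_colorings theta_neq0 theta_neq1 (color_coloring f)).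
Qed.
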